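(* Let $\mathcal T_1=(S_1,\Sigma_1,\kappa_1,\mathrm{AP},\mathcal L_1)$ and $\mathcal T_2=(S_2,\Sigma_2,\kappa_2,\mathrm{AP},\mathcal L_2)$ be labelled stochastic transition systems such that $\mathcal T_2$ is a denumerable Markov chain with a finite attractor and $\mathcal T_2$ is an $\alpha$-abstraction of $\mathcal T_1$ (as labelled systems), for a measurable $\alpha:S_1\to S_2$. Let $\mathcal M=(Q,q_0,E,\mathcal F)$ be a deterministic Muller automaton over $\mathrm{AP}$. Assume moreover that $\mathcal T_2\ltimes\mathcal M$ is a sound $\alpha_{\mathcal M}$-abstraction of $\mathcal T_1\ltimes\mathcal M$, where $\alpha_{\mathcal M}(s,q)=(\alpha(s),q)$, and that $B_2$ is a finite attractor of $\mathcal T_2\ltimes\mathcal M$. Then for every initial distribution $\mu\in\mathrm{Dist}(S_1)$ for $\mathcal T_1$: $$\mathrm{Prob}^{\mathcal T_1\ltimes\mathcal M}_{\mu\times\delta_{q_0}}(\mathrm{Inf}\in\mathcal F)=\sum_{C\in\mathrm{Good}^{B_2}_{\mathcal T_2\ltimes\mathcal M}(\mathcal F)}\mathrm{Prob}^{\mathcal T_1\ltimes\mathcal M}_{\mu\times\delta_{q_0}}\big(\mathbf F\,\alpha_{\mathcal M}^{-1}(C)\big).$$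
   Context: A labelled stochastic transition system (LSTS) is $\mathcal T=(S,\Sigma,\kappa,\mathrm{AP},\mathcal L)$ with $(S,\Sigma)$ a measurable space, $\kappa:S\times\Sigma\to[0,1]$ a Markov kernel, $\mathrm{AP}$ a finite set and $\mathcal L:S\to2^{\mathrm{AP}}$ measurable. It is a denumerable Markov chain if $S$ is at most countable and $\Sigma=2^S$. $\mathrm{Dist}(S)$ is the set of probability measures on $(S,\Sigma)$; $\mathrm{Prob}^{\mathcal T}_\mu$ is the law on $S^\omega$ (cylinder $\sigma$-algebra) of the Markov chain with initial distribution $\mu$ and kernel $\kappa$. $\mathbf F B$ is the event that $B$ is visited at some time $i\ge0$. $B\in\Sigma$ is an attractor for $\mathcal T$ if $\mathrm{Prob}^{\mathcal T}_\mu(\mathbf F B)=1$ for every $\mu\in\mathrm{Dist}(S)$. $\Omega_{\mathcal T}(\mu)(A)=\int_S\kappa(s,A)\,\mu(\mathrm ds)$; $\alpha_\#(\mu)(M)=\mu(\alpha^{-1}(M))$. $\mathcal T_2$ is an $\alpha$-abstraction of $\mathcal T_1$ if for every $\mu\in\mathrm{Dist}(S_1)$ the measures $\alpha_\#(\Omega_{\mathcal T_1}(\mu))$ and $\Omega_{\mathcal T_2}(\alpha_\#(\mu))$ have the same null sets; for labelled systems over the same $\mathrm{AP}$ one also requires $\alpha(s)=\alpha(s')\Rightarrow\mathcal L_1(s)=\mathcal L_1(s')$ and $\mathcal L_2(\alpha(s))=\mathcal L_1(s)$ for all $s,s'\in S_1$. An $\alpha$-abstraction is sound if for every $\mu\in\mathrm{Dist}(S_1)$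 and $B\in\Sigma_2$: $\mathrm{Prob}^{\mathcal T_2}_{\alpha_\#(\mu)}(\mathbf F B)=1$ implies $\mathrm{Prob}^{\mathcal T_1}_\mu(\mathbf F\alpha^{-1}(B))=1$. (Same definitions for $\mathcal T_i\ltimes\mathcal M$ and $\alpha_{\mathcal M}:S_1\times Q\to S_2\times Q$.) A deterministic Muller automaton over $\mathrm{AP}$ is $\mathcal M=(Q,q_0,E,\mathcal F)$ with $Q$ finite, $q_0\in Q$, $E\subseteq Q\times2^{\mathrm{AP}}\times Q$ such that for every $(q,u)$ there is exactly one $q'$ with $(q,u,q')\in E$, and $\mathcal F\subseteq2^Q$. The product $\mathcal T\ltimes\mathcal M$ is the LSTS with state space $S\times Q$, $\sigma$-algebra $\Sigma\otimes2^Q$, kernel $\kappa'((s,q),A\times\{q'\})=\kappa(s,A)$ if $(q,\mathcal L(s),q')\in E$ and $0$ otherwise, and labelling $(s,q)\mapsto q$. $\mathrm{Inf}\in\mathcal F$ is the event that the set of $q\in Q$ occurring infinitely often as second component along the path belongs to $\mathcal F$. $\mathrm{Graph}_{\mathcal T_2\ltimes\mathcal M}(B_2)$ is the finite directed graph with vertex set $B_2$ and an edge from $x$ to $y$ iff there is a path (finite sequence of positive-probability transitions) from $x$ to $y$ in $\mathcal T_2\ltimes\mathcal M$. A BSCC is a bottom strongly connected component of this graph. A BSCC $C$ is good for $\mathcal F$, written $C\in\mathrm{Good}^{B_2}_{\mathcal T_2\ltimes\mathcal M}(\mathcal F)$, if there is $F\in\mathcal F$ such that (a) for every $(s,q)\in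 S_2\times Q$ reachable by a path of $\mathcal T_2\ltimes\mathcal M$ from some element of $C$, $q\in F$; and (b) for every $q\in F$ there is $s\in S_2$ such that $(s,q)$ is reachable by a path from some element of $C$. *)

(* Defs.v *)
From HB Require Import structures.
From mathcomp Require Import all_boot all_order all_algebra.
From mathcomp Require Import all_classical all_reals all_analysis.
From mathcomp Require Import measurable_realfun zify.

Set Implicit Arguments.
Unset Strict Implicit.
Unset Printing Implicit Defensive.
Import Order.TTheory GRing.Theory Num.Theory.
Import numFieldNormedType.Exports.
Local Open Scope classical_set_scope.
Local Open Scope ring_scope.

(* infinite paths, with the sigma-algebra generated by the coordinates *)
Definition run (S : Type) := nat -> S.

Definition run_display (d : measure_display) : measure_display.
Proof. exact: d. Qed.

Section run_measurable.
Context d (S : measurableType d).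

Definition coordinate_sets : set (set (run S)) :=
  [set A | exists i (B : set S), measurable B /\ A = [set w | B (w i)]].

HB.instance Definition _ := Pointed.copy (run S) (nat -> S).

Let run_measurable0 : <<s coordinate_sets >> (set0 : set (run S)).
Proof. exact: sigma_algebra0. Qed.

Let run_measurableC A :
  <<s coordinate_sets >> A -> <<s coordinate_sets >> (~` A).
Proof. exact: sigma_algebraC. Qed.

Let run_measurable_bigcup (F : (set (run S))^nat) :
  (forall i, <<s coordinate_sets >> (F i)) ->
  <<s coordinate_sets >> (\bigcup_i F i).
Proof. exact: sigma_algebra_bigcup. Qed.

HB.instance Definition _ := @isMeasurable.Build (run_display d) (run S)
  <<s coordinate_sets >> run_measurable0 run_measurableC run_measurable_bigcup.

Lemma measurable_coord (i : nat) :
  measurable_fun [set: run S] (fun w : run S => w i).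
Proof.
by move=> _ B mB; rewrite setTI; apply: sub_sigma_algebra; exists i, B.
Qed.

Lemma measurable_to_run d' (T : measurableType d') (f : T -> run S) :
  (forall i, measurable_fun [set: T] (fun t => f t i)) ->
  measurable_fun [set: T] f.
Proof.
move=> mf; apply: (@measurability _ _ _ _ _ _ coordinate_sets) => //.
move=> _ [_ [i [B [mB ->]]] <-].
exact: (mf i).
Qed.

End run_measurable.

Section chain_law.
Local Open Scope ereal_scope.
Context d (S : measurableType d) (R : realType) (k : R.-pker S ~> S).

(* fdd n A x is the probability that the chain with kernel k started at x
   satisfies X_0 \in A 0, ..., X_n \in A n *)
Fixpoint fdd (n : nat) (A : nat -> set S) (x : S) : \bar R :=
  match n with
  | 0%N => (\1_(A 0%N) x)%:E
  | m.+1 => (\1_(A 0%N) x)%:E * \int[k x]_y fdd m (fun i => A i.+1) y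
  end.

Definition is_chain_law (mu : probability S R) (P : probability (run S) R) :=
  forall (n : nat) (A : nat -> set S), (forall i, measurable (A i)) ->
    P [set w | forall i, (i <= n)%N -> A i (w i)] = \int[mu]_x fdd n A x.

End chain_law.

(* Ionescu-Tulcea: the frozen chains Qr define a content on the algebra of
   sets depending on finitely many coordinates; it is continuous at set0, hence
   extends to a probability measure *)
Module IonescuTulcea.
Section construction.
Local Open Scope ereal_scope.
Context d (S : measurableType d) (R : realType) (k : R.-pker S ~> S).

Definition splice (n : nat) (w : run S) (y : S) : run S :=
  fun i => if (i <= n)%N then w i else y.

Let measurable_splice n :
  measurable_fun [set: run S * S] (fun p => splice n p.1 p.2).
Proof.
apply: measurable_to_run => i; rewrite /splice; case: (i <= n)%N.
  exact: (measurableT_comp (measurable_coord i) measurable_fst).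
exact: measurable_snd.
Qed.

Definition kc n (w : run S) : {measure set S -> \bar R} := k (w n).

Let mkc n U : measurable U -> measurable_fun [set: run S] (kc n ^~ U).
Proof.
move=> mU.
exact: (@measurableT_comp _ _ _ _ _ _ (k ^~ U) _ (fun w : run S => w n)
  (measurable_kernel k U mU) (measurable_coord n)).
Qed.

HB.instance Definition _ n := isKernel.Build _ _ _ _ R (kc n) (mkc n).

Let kc1 n w : kc n w [set: S] = 1. Proof. exact: prob_kernel. Qed.

HB.instance Definition _ n := Kernel_isProbability.Build _ _ _ _ R (kc n) (kc1 n).

Fixpoint Qr (j n : nat) (w : run S) (A : set (run S)) : \bar R :=
  match j with
  | 0%N => (\1_A w)%:E
  | j.+1 => \int[k (w n)]_y Qr j n.+1 (splice n w y) A
  end.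

Let Qr_ge0 j n w A : 0 <= Qr j n w A.
Proof.
elim: j n w => [|j IH] n w /=; first by rewrite lee_fin.
exact: integral_ge0.
Qed.

Let measurable_Qr j n A : measurable A ->
  measurable_fun [set: run S] (fun w => Qr j n w A).
Proof.
move=> mA; elim: j n => [|j IH] n /=.
  by apply/measurable_EFinP; exact: measurable_indic.
apply: (measurable_fun_integral_sfinite_kernel
  (fun p => Qr j n.+1 (splice n p.1 p.2) A) (kc n)) => //.
exact: (measurableT_comp (IH n.+1) (measurable_splice n)).
Qed.

Let measurable_Qry j n w A : measurable A ->
  measurable_fun [set: S] (fun y => Qr j n.+1 (splice n w y) A).
Proof.
move=> mA; apply: (measurableT_comp (measurable_Qr j n.+1 mA)).
exact: (measurableT_comp (measurable_splice n) (pair1_measurable w)).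
Qed.

Let integral_cst1 (nu : {measure set S -> \bar R}) (c : \bar R) :
  nu [set: S] = 1 -> \int[nu]_y c = c.
Proof. by move=> h; rewrite integral_cst// h mule1. Qed.

Let Qr_le1 j n w A : measurable A -> Qr j n w A <= 1.
Proof.
move=> mA; elim: j n w => [|j IH] n w /=.
  by rewrite lee_fin indicE; case: (_ \in _).
rewrite -[leRHS](integral_cst1 1 (prob_kernel (s := k) (w n))).
by apply: ge0_le_integral => //; exact: measurable_Qry.
Qed.

Let Qr_add j n w A B : measurable A -> measurable B -> A `&` B = set0 ->
  Qr j n w (A `|` B) = Qr j n w A + Qr j n w B.
Proof.
move=> mA mB AB0; elim: j n w => [|j IH] n w /=.
  rewrite -EFinD !indicE in_setU; have [Aw|_] := boolP (w \in A); last first.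
    by rewrite add0r.
  rewrite [w \in B]memNset ?addr0// => Bw.
  by have : (A `&` B) w; [split; [exact: set_mem|]|rewrite AB0].
rewrite -ge0_integralD//; try exact: measurable_Qry.
by apply: eq_integral => y _; rewrite IH.
Qed.

Definition dep (m : nat) (A : set (run S)) :=
  forall w w' : run S, (forall i, (i <= m)%N -> w i = w' i) -> A w -> A w'.

Let depW m m' A : (m <= m')%N -> dep m A -> dep m' A.
Proof.
move=> mm' dA w w' ww'; apply: dA => i im; apply: ww'.
exact: leq_trans mm'.
Qed.

Let dep_indic m A w w' : dep m A -> (forall i, (i <= m)%N -> w i = w' i) ->
  \1_A w = \1_A w' :> R.
Proof.
move=> dA ww'; rewrite !indicE; congr (_ %:R); congr nat_of_bool.
apply/idP/idP => /set_mem h; apply/mem_set; apply: dA h => // i im.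
by rewrite ww'.
Qed.

Let Qr_dep0 j n w A : dep n A -> Qr j n w A = (\1_A w)%:E.
Proof.
elim: j n w => [//|j IH] n w dA /=.
rewrite -[RHS](integral_cst1 _ (prob_kernel (s := k) (w n))).
apply: eq_integral => y _; rewrite IH; last exact: depW dA.
by congr EFin; apply: (dep_indic dA) => i im; rewrite /splice im.
Qed.

Let Qr_dep m j j' n w A : dep m A -> (m <= n + j)%N -> (m <= n + j')%N ->
  Qr j n w A = Qr j' n w A.
Proof.
move=> dA; elim: j j' n w => [|j IH] [|j'] n w.
- by [].
- rewrite addn0 => mn _; rewrite [RHS]Qr_dep0//; exact: depW dA.
- rewrite addn0 => _ mn; rewrite [LHS]Qr_dep0//; exact: depW dA.
- move=> h h' /=; apply: eq_integral => y _; apply: IH; by rewrite addSnnS.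
Qed.

Definition cyl : Type := run S.
HB.instance Definition _ := Pointed.on cyl.
Definition cyl_measurable : set (set cyl) :=
  [set A | (measurable (A : set (run S))) /\ exists m, dep m A].

Let cyl0 : cyl_measurable set0.
Proof. by split=> //; exists 0%N. Qed.

Let cylU : setU_closed cyl_measurable.
Proof.
move=> A B [mA [m dA]] [mB [m' dB]]; split; first exact: measurableU.
exists (maxn m m') => w w' ww' [Aw|Bw]; [left|right].
- by apply: dA Aw => i im; apply: ww'; rewrite leq_max im.
- by apply: dB Bw => i im; apply: ww'; rewrite leq_max im orbT.
Qed.

Let cylC : setC_closed cyl_measurable.
Proof.
move=> A [mA [m dA]]; split; first exact: measurableC.
exists m => w w' ww' Aw Aw'; apply: Aw; apply: dA Aw' => i im.
by rewrite ww'.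
Qed.

HB.instance Definition _ := @isAlgebraOfSets.Build d cyl cyl_measurable
  cyl0 cylU cylC.

Definition pr n w A := Qr (xget 0%N [set m | dep m A]) n w A.

Let prE m j n w A : dep m A -> (m <= n + j)%N -> pr n w A = Qr j n w A.
Proof.
move=> dA h; rewrite /pr; case: xgetP => [m' _ dA'|/(_ m)//].
have [mm|mm] := leqP m m'.
  by apply: (Qr_dep w dA) => //; rewrite (leq_trans mm)// leq_addl.
by apply: (Qr_dep w dA'); [exact: leq_addl|exact: leq_trans (ltnW mm) _].
Qed.

Let pr_dep n w A : dep n A -> pr n w A = (\1_A w)%:E.
Proof. by move=> dA; rewrite (prE (j:=0%N) w dA) ?addn0. Qed.

Let pr_step n w A m : dep m A ->
  pr n w A = \int[k (w n)]_y pr n.+1 (splice n w y) A.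
Proof.
move=> dA; rewrite (prE (j := m.+1) w dA) ?addnS; last first.
  by rewrite ltnW// ltnS leq_addl.
rewrite /=; apply: eq_integral => y _.
by rewrite -(prE _ dA)// leq_addl.
Qed.

Let pr_ge0 n w A : 0 <= pr n w A.
Proof. exact: Qr_ge0. Qed.

Let pr_le1 n w A m : measurable A -> dep m A -> pr n w A <= 1.
Proof. by move=> mA dA; rewrite (prE (j := m) w dA)// ?leq_addl//; exact: Qr_le1. Qed.

Let measurable_pr n A m : measurable A -> dep m A ->
  measurable_fun [set: run S] (fun w => pr n w A).
Proof.
move=> mA dA; under eq_fun do rewrite (prE (j := m) _ dA) ?leq_addl//.
exact: measurable_Qr.
Qed.

Let pr_add n w A B : cyl_measurable A -> cyl_measurable B -> A `&` B = set0 ->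
  pr n w (A `|` B) = pr n w A + pr n w B.
Proof.
move=> cA cB AB0; have [_ [m'' dAB]] := cylU cA cB.
case: cA => mA [m dA]; case: cB => mB [m' dB].
pose j := (m + m' + m'')%N.
rewrite (prE (j := j) w dAB) ?(prE (j := j) w dA) ?(prE (j := j) w dB)
  ?Qr_add// /j; lia.
Qed.

Let pr_le n w A B : cyl_measurable A -> cyl_measurable B -> A `<=` B ->
  pr n w A <= pr n w B.
Proof.
move=> cA cB AB.
have cD : cyl_measurable (B `\` A).
  by rewrite setDE -[B]setCK -setCU; apply: cylC; apply: cylU => //; exact: cylC.
rewrite -(setDUK AB) pr_add//; last by rewrite setDE setICA setICr setI0.
by rewrite leeDl.
Qed.

Variable mu : probability S R.

Definition Pi (A : set cyl) : \bar R := \int[mu]_x pr 0 (fun=> x) A.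

Let measurable_cstrun :
  measurable_fun [set: S] (fun x : S => (fun=> x) : run S).
Proof. by apply: measurable_to_run => i; exact: measurable_id. Qed.

Let measurable_pr0 A : cyl_measurable A ->
  measurable_fun [set: S] (fun x : S => pr 0 (fun=> x) A).
Proof.
case=> mA [m dA].
exact: (measurableT_comp (measurable_pr 0 mA dA) measurable_cstrun).
Qed.

Let Pi_ge0 A : 0 <= Pi A. Proof. exact: integral_ge0. Qed.

Let cylD A B : cyl_measurable A -> cyl_measurable B -> cyl_measurable (A `\` B).
Proof.
by move=> cA cB; rewrite setDE -[A]setCK -setCU; apply/cylC/cylU => //; exact: cylC.
Qed.

Let Pi_setT : Pi setT = 1.
Proof.
rewrite -[RHS](integral_cst1 1 (probability_setT mu)); apply: eq_integral => x _.
by rewrite pr_dep// indicT.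
Qed.

Let Pi_set0 : Pi set0 = 0.
Proof.
rewrite /Pi integral0_eq// => x _.
by rewrite pr_dep// indic0.
Qed.

Let Pi_add2 : additive2 Pi.
Proof.
move=> A B mA mB AB0; rewrite /Pi -ge0_integralD//; last 2 first.
- exact: measurable_pr0.
- exact: measurable_pr0.
by apply: eq_integral => x _; rewrite pr_add.
Qed.

Let Pi_semi_additive : measure_function.semi_additive Pi.
Proof. by apply/additive2P => //; exact: Pi_set0. Qed.

HB.instance Definition _ := @isContent.Build d cyl R Pi Pi_ge0 Pi_semi_additive.

Let Pi_le1 A : cyl_measurable A -> Pi A <= 1.
Proof.
move=> cA; rewrite -Pi_setT; apply: ge0_le_integral => //.
- exact: measurable_pr0.
- by apply: measurable_pr0; rewrite -setC0; exact: cylC.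
- by move=> x _; apply: pr_le => //; rewrite -setC0; exact: cylC.
Qed.

Let Pi_fin A : cyl_measurable A -> Pi A \is a fin_num.
Proof.
by move=> cA; rewrite ge0_fin_numE// (le_lt_trans (Pi_le1 cA))// ltry.
Qed.

Let integral_cvg0 (nu : {measure set S -> \bar R}) (f : nat -> S -> \bar R) :
  nu [set: S] = 1 -> (forall n, measurable_fun [set: S] (f n)) ->
  (forall n y, 0 <= f n y) -> (forall n y, f n y <= 1) ->
  (forall y, f n y @[n --> \oo] --> 0) ->
  \int[nu]_y f n y @[n --> \oo] --> 0.
Proof.
move=> nu1 mf f0 f1 fcvg.
have [] := @dominated_convergence _ _ _ nu setT measurableT f (cst 0) (cst 1).
- by [].
- exact: measurable_cst.
- by apply: aeW => y _; exact: fcvg.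
- apply/integrableP; split; first exact: measurable_cst.
  by rewrite /= normr1 integral_cst1// ltry.
- by apply: aeW => y n _; rewrite gee0_abs.
- by move=> _ _; rewrite integral0.
Qed.

Let Pi_cvg0 (A : nat -> set cyl) : (forall n, cyl_measurable (A n)) ->
  (forall n, A n.+1 `<=` A n) -> \bigcap_n A n = set0 ->
  Pi (A n) @[n --> \oo] --> 0.
Proof.
move=> cA ndA A0; apply: contrapT => bad0.
have ndA' i j : (i <= j)%N -> A j `<=` A i.
  move=> /subnKC <-; elim: (j - i)%N => [|l IH]; first by rewrite addn0.
  by rewrite addnS; exact: subset_trans IH.
have mA n : measurable (A n : set (run S)) by case: (cA n).
have dA n : exists m, dep m (A n) by case: (cA n).
pose bad n w := ~ (pr n w (A i) @[i --> \oo] --> 0).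
have [x0 badx0] : exists x, bad 0%N (fun=> x).
  apply: contrapT => /forallNP h; apply: bad0.
  apply: integral_cvg0 => //.
  - exact: probability_setT.
  - by move=> n; exact: measurable_pr0.
  - by move=> n y; have [m /(pr_le1 0 (fun=> y) (mA n))] := dA n.
  - by move=> y; apply: contrapT; exact: h.
have step n w : exists y, bad n w -> bad n.+1 (splice n w y).
  apply: contrapT => /forallNP h.
  have badw : bad n w by apply: contrapT => b; apply: (h point) => /b.
  apply: badw.
  under eq_fun => i do (have [m dm] := dA i; rewrite (pr_step n w dm); clear m dm).
  apply: integral_cvg0 => //.
  - exact: prob_kernel.
  - move=> i; have [m dm] := dA i.
    apply: (measurableT_comp (measurable_pr n.+1 (mA i) dm)).
    exact: (measurableT_comp (measurable_splice n) (pair1_measurable w)).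
  - by move=> i y; have [m dm] := dA i; exact: pr_le1 dm.
  - by move=> y; apply: contrapT => b; apply: (h y).
pose nxt n w := projT1 (cid (step n w)).
pose ws := fix ws n : run S := if n is n'.+1 then splice n' (ws n') (nxt n' (ws n'))
                               else (fun=> x0).
have bws n : bad n (ws n).
  by elim: n => [//|n IH] /=; exact: (projT2 (cid (step n (ws n)))).
have wsE i m : (i <= m)%N -> ws m i = ws i i.
  move=> /subnKC <-; elim: (m - i)%N => [|l IH]; first by rewrite addn0.
  by rewrite addnS /= /splice leq_addr.
have : (\bigcap_n A n) (fun i => ws i i); last by rewrite A0.
move=> n _; have [m dm] := dA n.
apply: (dm (ws m)) => [i im|]; first by rewrite (wsE _ _ im).
apply: contrapT => wsA; apply: (bws m).
apply: cvg_near_cst; exists n => // i /= ni.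
apply/eqP; rewrite eq_le pr_ge0 andbT.
rewrite (le_trans (pr_le m (ws m) (cA i) (cA n) (ndA' _ _ ni)))//.
by rewrite pr_dep// indicE memNset.
Qed.

Let Pi_sigma_additive : semi_sigma_additive Pi.
Proof.
move=> F mF tF mUF.
pose U := \bigcup_n F n.
pose A n := U `\` \big[setU/set0]_(i < n) F i.
have mB n : measurable (\big[setU/set0]_(i < n) F i) by exact: bigsetU_measurable.
have PiU n : \sum_(0 <= i < n) Pi (F i) = Pi U - Pi (A n).
  rewrite big_mkord -measure_bigsetU//.
  have -> : Pi U = Pi (\big[setU/set0]_(i < n) F i) + Pi (A n).
    rewrite -(Pi_add2 (mB n) (cylD mUF (mB n))).
      by rewrite setDUK//; exact: bigsetU_bigcup.
    by rewrite setDE setICA setICr setI0.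
  by rewrite addeK// (Pi_fin (cylD mUF (mB n))).
suff : Pi U - Pi (A n) @[n --> \oo] --> Pi U - 0.
  by rewrite sube0; apply: cvg_trans; apply: near_eq_cvg; apply: nearW => n; rewrite PiU.
apply: cvgeB.
- by rewrite fin_num_adde_defr// Pi_fin.
- exact: cvg_cst.
apply: Pi_cvg0.
- by move=> n; exact: (cylD mUF (mB n)).
- by move=> n x [Ux nx]; split=> // xn; apply: nx; rewrite big_ord_recr; left.
- rewrite -subset0 => x Ax; have [[n _ Fx] _] := Ax 0%N I.
  have [_] := Ax n.+1 I; apply; rewrite big_ord_recr; by right.
Qed.

HB.instance Definition _ := @Content_isMeasure.Build d cyl R Pi Pi_sigma_additive.

Let run_cyl (A : set (run S)) :
  measurable A -> <<s (@measurable _ cyl) >> (A : set cyl).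
Proof.
apply: (smallest_sub _).
  exact: smallest_sigma_algebra.
move=> _ [i [B [mB ->]]]; apply: sub_sigma_algebra; split.
  by apply: sub_sigma_algebra; exists i, B.
by exists i => w w' ww' /=; rewrite ww'.
Qed.

Definition P0 (A : set (run S)) : \bar R := @measure_extension d cyl R Pi A.

Let P0_0 : P0 set0 = 0. Proof. exact: measure0. Qed.

Let P0_ge0 A : 0 <= P0 A. Proof. exact: measure_ge0. Qed.

Let P0_sigma_additive : semi_sigma_additive P0.
Proof.
move=> F mF tF mUF.
apply: (@measure_semi_sigma_additive _ _ _ (@measure_extension d cyl R Pi)) => //.
- by move=> i; exact: run_cyl.
- exact: run_cyl.
Qed.

HB.instance Definition _ := @isMeasure.Build _ (run S) R P0 P0_0 P0_ge0 P0_sigma_additive.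

Let P0E A : cyl_measurable A -> P0 A = Pi A.
Proof. by move=> cA; apply: measurable_mu_extE. Qed.

Let P0_setT : P0 setT = 1.
Proof. by rewrite P0E// -setC0; exact: cylC. Qed.

HB.instance Definition _ := Measure_isProbability.Build _ _ _ P0 P0_setT.

Definition box n N (A : nat -> set S) : set (run S) :=
  [set w | forall i, (i <= N)%N -> A i (w (n + i)%N)].

Let dep_box n N A : dep (n + N) (box n N A).
Proof.
by move=> w w' ww' h i iN; rewrite -ww' ?leq_add2l//; exact: h.
Qed.

Let mbox n N A : (forall i, measurable (A i)) -> measurable (box n N A).
Proof.
move=> mA.
have -> : box n N A = \bigcap_(i in `I_N.+1) ((fun w : run S => w (n + i)%N) @^-1` A i).
  by apply/seteqP; split=> w h i /= iN; exact: h.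
apply: bigcap_measurableType => i _.
by rewrite -[X in measurable X]setTI; apply: measurable_coord.
Qed.

Let Qr_box N n w (A : nat -> set S) E : dep n E ->
  Qr N n w (E `&` box n N A) = (\1_E w)%:E * fdd k N A (w n).
Proof.
elim: N n w A E => [|N IH] n w A E dE /=.
  rewrite -EFinM !indicE -natrM mulnb; congr (_%:R%:E); congr nat_of_bool.
  rewrite in_setI; congr (_ && _); apply/idP/idP => /set_mem h; apply/mem_set.
    by have := h 0%N isT; rewrite addn0.
  by case=> // _; rewrite addn0.
pose E' := E `&` [set w : run S | A 0%N (w n)].
have dE' : dep n E'.
  by move=> v v' vv' [Ev Av]; split; [exact: dE Ev|rewrite /= -vv'].
have -> : E `&` box n N.+1 A = E' `&` box n.+1 N (fun i => A i.+1).
  apply/seteqP; split=> v.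
    move=> [Ev h]; split; first by split=> //; have := h 0%N isT; rewrite addn0.
    by move=> i iN; have := h i.+1 iN; rewrite addnS addSn.
  move=> [[Ev Av] h]; split=> // -[|i] iN; first by rewrite addn0.
  by rewrite addnS -addSn; exact: h.
rewrite muleA -EFinM.
have -> : (\1_E w * \1_(A 0%N) (w n) = \1_E' w :> R)%R.
  rewrite !indicE -natrM mulnb in_setI; congr (_%:R); congr nat_of_bool.
have dE'S : dep n.+1 E' by exact: depW dE'.
transitivity (\int[k (w n)]_y ((\1_E' w)%:E * fdd k N (fun i => A i.+1) y)).
  apply: eq_integral => y _; rewrite IH//; congr (_ * _).
    by congr EFin; apply: (dep_indic dE') => i im; rewrite /splice im.
  by rewrite /splice ltnn.
rewrite indicE; case: (w \in E'); last first.
  by rewrite mul0e; apply: integral0_eq => y _; rewrite mul0e.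
by rewrite mul1e; apply: eq_integral => y _; rewrite mul1e.
Qed.

Lemma exists_law : exists P : probability (run S) R, is_chain_law k mu P.
Proof.
exists P0 => n A mA.
transitivity (P0 (box 0 n A)) => //.
rewrite P0E; last by split; [exact: mbox|exists n; exact: (@dep_box 0 n A)].
apply: eq_integral => x _.
rewrite (prE (j := n) _ (@dep_box 0 n A))//.
by rewrite -[box _ _ _]setTI Qr_box// indicT mul1e.
Qed.

End construction.
End IonescuTulcea.

Section chain_law_theory.
Local Open Scope ereal_scope.
Context d (S : measurableType d) (R : realType) (k : R.-pker S ~> S).

Lemma chain_law_exists (mu : probability S R) : exists P, is_chain_law k mu P.
Proof. exact: IonescuTulcea.exists_law. Qed.

Lemma chain_law_unique (mu : probability S R) (P P' : probability (run S) R) :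
  is_chain_law k mu P -> is_chain_law k mu P' ->
  forall A, measurable A -> P A = P' A.
Proof.
move=> lP lP' A mA.
pose G : set (set (run S)) := [set B | exists n (C : nat -> set S),
  (forall i, measurable (C i)) /\ B = [set w | forall i, (i <= n)%N -> C i (w i)]].
have GT : G setT.
  by exists 0%N, (fun=> setT); split=> //; apply/seteqP; split.
apply: (measure_unique G (fun=> setT)) => //.
- apply/seteqP; split; apply: smallest_sub; try exact: smallest_sigma_algebra.
    move=> _ [i [B [mB ->]]]; apply: sub_sigma_algebra.
    exists i, (fun j => if j == i then B else setT); split.
      by move=> j; case: eqP.
    apply/seteqP; split=> [w Bw j _|w /(_ i (leqnn i))]; last by rewrite eqxx.
    by case: eqP => // ->.
  move=> _ [n [C [mC ->]]].
  have -> : [set w : run S | forall i, (i <= n)%N -> C i (w i)] =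
      \bigcap_(i in `I_n.+1) ((fun w : run S => w i) @^-1` C i).
    by apply/seteqP; split=> w h i /= iN; exact: h.
  apply: bigcap_measurableType => i _.
  by rewrite -[X in measurable X]setTI; apply: measurable_coord.
- move=> _ _ [n [C [mC ->]]] [n' [C' [mC' ->]]].
  exists (maxn n n'), (fun i => (if (i <= n)%N then C i else setT) `&`
                               (if (i <= n')%N then C' i else setT)); split.
    by move=> i; apply: measurableI; case: ifP.
  apply/seteqP; split=> [w [h h'] i _|w h].
    by split; case: ifP => // ii; [exact: h|exact: h'].
  split=> i ii.
    by have [] := h i; [rewrite leq_max ii|rewrite ii].
  by have [] := h i; [rewrite leq_max ii orbT|rewrite ii].
- by rewrite bigcup_const//; exists 0%N.
- by move=> _ [n [C [mC ->]]]; exact: (etrans (lP n C mC) (esym (lP' n C mC))).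
- by move=> _; apply: (le_lt_trans (probability_le1 P measurableT)); rewrite ltry.
Qed.

(* determined on measurable sets by chain_lawP and chain_law_unique *)
Definition chain_law (mu : probability S R) : probability (run S) R :=
  projT1 (cid (chain_law_exists mu)).

Lemma chain_lawP (mu : probability S R) : is_chain_law k mu (chain_law mu).
Proof. exact: projT2 (cid (chain_law_exists mu)). Qed.

End chain_law_theory.

Record lsts (R : realType) (AP : finType) d (S : measurableType d) := Lsts {
  trans : R.-pker S ~> S ;
  label : S -> {set AP} ;
  label_measurable : forall U : set {set AP}, measurable (label @^-1` U) }.

Definition denumerable_chain d (S : measurableType d) :=
  countable [set: S] /\ forall A : set S, measurable A.

Section lsts_theory.
Local Open Scope ereal_scope.
Context (R : realType) (AP : finType) d (S : measurableType d).
Implicit Types (T : lsts R AP S) (mu : probability S R) (B : set S).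

Definition Prob T mu : probability (run S) R := chain_law (trans T) mu.

Definition eventually_in B : set (run S) := [set w | exists i, B (w i)].

Definition attractor T B :=
  measurable B /\ forall mu, Prob T mu (eventually_in B) = 1.

(* one-step transformer on distributions *)
Definition Omega T mu (A : set S) : \bar R := \int[mu]_s trans T s A.

Definition step T : rel S := fun x y => `[< 0 < trans T x [set y] >].

End lsts_theory.

Section abstraction.
Local Open Scope ereal_scope.
Context (R : realType) (AP : finType) d1 (S1 : measurableType d1)
  d2 (S2 : measurableType d2).
Variables (T1 : lsts R AP S1) (T2 : lsts R AP S2) (alpha : {mfun S1 >-> S2}).

(* both measures have the same null sets *)
Definition abstraction :=
  forall (mu : probability S1 R) (B : set S2), measurable B ->
    pushforward (Omega T1 mu) alpha B = 0 <->
    Omega T2 (distribution mu alpha) B = 0.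

Definition labelled_abstraction :=
  [/\ abstraction,
      forall s s', alpha s = alpha s' -> label T1 s = label T1 s' &
      forall s, label T2 (alpha s) = label T1 s].

Definition sound :=
  forall (mu : probability S1 R) (B : set S2), measurable B ->
    Prob T2 (distribution mu alpha) (eventually_in B) = 1 ->
    Prob T1 mu (eventually_in (alpha @^-1` B)) = 1.

End abstraction.

Record muller (AP : finType) := Muller {
  mstate : finType ;
  minit : mstate ;
  mtrans : {set mstate * {set AP} * mstate} ;
  mtrans_fun : forall q u, exists! q', (q, u, q') \in mtrans ;
  macc : {set {set mstate}} }.

(* mstate M made a measurable space: discrete sigma-algebra, and minit M as the
   point required by measurableType *)
Definition states (AP : finType) (M : muller AP) : Type := mstate M.

Section states_instances.
Context (AP : finType) (M : muller AP).
HB.instance Definition _ := Finite.on (states M).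
HB.instance Definition _ := isPointed.Build (states M) (minit M).
HB.instance Definition _ := @isMeasurable.Build default_measure_display
  (states M) discrete_measurable discrete_measurable0
  discrete_measurableC discrete_measurableU.
End states_instances.

Section product.
Local Open Scope ereal_scope.
Context (R : realType) (AP : finType) d (S : measurableType d).
Variables (T : lsts R AP S) (M : muller AP).
Local Notation Q := (states M).

(* kernel of the product: the unique measure whose value on A `*` [set q'] is
   trans T s A if (q, label T s, q') is a transition and 0 otherwise *)
Definition prod_trans (x : S * Q) (A : set (S * Q)) : \bar R :=
  \sum_(q' : Q | (x.2, label T x.1, q') \in mtrans M)
    trans T x.1 [set s | A (s, q')].

Lemma prod_transX (x : S * Q) (A : set S) (q' : Q) :
  prod_trans x (A `*` [set q']) =
  if (x.2, label T x.1, q') \in mtrans M then trans T x.1 A else 0.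
Proof.
rewrite /prod_trans; case: ifPn => [h|h].
  rewrite (bigD1 q')//= big1 ?adde0.
    by congr (trans T _ _); apply/seteqP; split=> [s []|s].
  move=> q /andP[_ /eqP qq']; rewrite (_ : [set _ | _] = set0) ?measure0//.
  by apply/seteqP; split=> // s [_ /= e]; apply: qq'.
rewrite big1// => q qE; rewrite (_ : [set _ | _] = set0) ?measure0//.
by apply/seteqP; split=> // s [_ /= e]; move: h; rewrite -e qE.
Qed.

Let msect (A : set (S * Q)) (q : Q) : measurable A -> measurable [set s | A (s, q)].
Proof.
move=> mA; rewrite -[X in measurable X]setTI.
by apply: (pair2_measurable q).
Qed.

Let prod_trans_eq (x : S * Q) : exists q', forall A,
  prod_trans x A = trans T x.1 [set s | A (s, q')].
Proof.
have [q' [hq' uq']] := mtrans_fun x.2 (label T x.1); exists q' => A.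
rewrite /prod_trans (@big_pred1 _ _ _ Q (q' : Q))// => q /=.
by apply/idP/eqP => [/uq'|->].
Qed.

Let prod_trans0 x : prod_trans x set0 = 0.
Proof. by have [q ->] := prod_trans_eq x; rewrite measure0. Qed.

Let prod_trans_ge0 x A : 0 <= prod_trans x A.
Proof. by have [q ->] := prod_trans_eq x. Qed.

Let prod_trans_sigma_additive x : semi_sigma_additive (prod_trans x).
Proof.
have [q qE] := prod_trans_eq x.
have -> : prod_trans x = pushforward (trans T x.1) (fun s => (s, q)).
  by apply/funext => A; rewrite qE.
move=> F mF tF mUF; rewrite /pushforward preimage_bigcup.
apply: measure_semi_sigma_additive.
- by move=> i; exact: msect.
- apply/trivIsetP => i j _ _ ij; rewrite -preimage_setI.
  by move/trivIsetP : tF => /(_ _ _ _ _ ij) ->//; rewrite preimage_set0.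
- by rewrite -preimage_bigcup; exact: msect.
Qed.

HB.instance Definition _ x := isMeasure.Build _ _ _ (prod_trans x)
  (prod_trans0 x) (prod_trans_ge0 x) (@prod_trans_sigma_additive x).

Definition prod_kernel : S * Q -> {measure set (S * Q) -> \bar R} := prod_trans.

Let prod_measurable_kernel U : measurable U ->
  measurable_fun [set: S * Q] (prod_kernel ^~ U).
Proof.
move=> mU; rewrite /prod_kernel /= /prod_trans.
under eq_fun do rewrite big_mkcond.
apply: emeasurable_sum => q'.
apply: measurable_fun_ifT => //; last first.
  exact: (@measurableT_comp _ _ _ _ _ _ (trans T ^~ [set s | U (s, q')]) _ fst
    (measurable_kernel (trans T) _ (msect q' mU)) measurable_fst).
apply: (measurable_fun_bool true); rewrite setTI.
have -> : (fun x : S * Q => (x.2, label T x.1, q') \in mtrans M) @^-1` [set true] =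
    \bigcup_(q in [set: Q])
      ((label T @^-1` [set u | (q, u, q') \in mtrans M]) `*` [set q]).
  apply/seteqP; split=> [[s q] /= h|[s q] [q0 _ [/= h ->]]//].
  by exists q.
apply: fin_bigcup_measurable => // q _; apply: measurableX => //.
rewrite [X in measurable X](_ : _ =
  label T @^-1` [set` [set u | (q, u, q') \in mtrans M]%SET]).
  exact: label_measurable.
by apply/seteqP; split=> s /=; rewrite inE.
Qed.

HB.instance Definition _ :=
  isKernel.Build _ _ _ _ R prod_kernel prod_measurable_kernel.

Let prod_kernel1 x : prod_kernel x [set: S * Q] = 1.
Proof.
have [q qE] := prod_trans_eq x.
rewrite /prod_kernel/= qE (_ : [set _ | _] = setT) ?prob_kernel//.
Qed.

HB.instance Definition _ :=
  Kernel_isProbability.Build _ _ _ _ R prod_kernel prod_kernel1.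

(* the label q of (s, q) is read as the singleton {q}, the atomic propositions of
   the product being the states of M *)
Definition prod_label (x : S * Q) : {set mstate M} := [set (x.2 : mstate M)]%SET.

Let prod_label_measurable (U : set {set mstate M}) :
  measurable (prod_label @^-1` U).
Proof.
rewrite -[X in measurable X]setTI.
exact: (@measurable_snd _ _ S Q measurableT [set q : Q | U [set (q : mstate M)]%SET]).
Qed.

Definition prod_lsts : lsts R (mstate M) (S * Q)%type :=
  Lsts prod_kernel prod_label_measurable.

End product.

Section lift.
Context d1 (S1 : measurableType d1) d2 (S2 : measurableType d2).
Context (AP : finType) (M : muller AP) (alpha : {mfun S1 >-> S2}).

Definition lift_abs (x : S1 * states M) : S2 * states M := (alpha x.1, x.2).

Let measurable_lift_abs : measurable_fun [set: S1 * states M] lift_abs.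
Proof.
apply: measurable_fun_pair; last exact: measurable_snd.
exact: (measurableT_comp (measurable_funPT alpha) measurable_fst).
Qed.

HB.instance Definition _ :=
  isMeasurableFun.Build _ _ _ _ lift_abs measurable_lift_abs.

End lift.

Definition Inf_in (S : Type) (AP : finType) (M : muller AP)
    (F : {set {set mstate M}}) : set (run (S * states M)) :=
  [set w | [set q : mstate M | `[< forall n, exists2 m, (n <= m)%N
                                  & (w m).2 = q >]]%SET \in F].

(* p may be empty, so that reach is reflexive *)
Definition reach (V : Type) (e : rel V) (x y : V) : Prop :=
  exists2 p : seq V, path e x p & last x p = y.

Section digraph.
Context (V : Type) (vert : set V) (e : rel V).

(* strongly connected component: a class of mutual reachability *)
Definition scc (C : set V) : Prop :=
  exists2 x, vert x & C = [set y | [/\ vert y, reach e x y & reach e y x]].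

Definition bscc (C : set V) : Prop :=
  scc C /\ forall x y, C x -> vert y -> e x y -> C y.

End digraph.

Section good.
Context (R : realType) (AP : finType) d (S : measurableType d).
Variables (T : lsts R AP S) (M : muller AP) (B : set (S * states M)).
Let path_to := reach (step (prod_lsts T M)).

Definition graph : rel (S * states M) := fun x y => `[< [/\ B x, B y & path_to x y] >].

Definition Good (F : {set {set mstate M}}) : set (set (S * states M)) :=
  [set C | bscc B graph C /\ exists2 G : {set mstate M}, G \in F &
    (forall c s q, C c -> path_to c (s, q) -> q \in G) /\
    (forall q, q \in G -> exists c s, C c /\ path_to c (s, q))].

End good.

(* Main.v *)
Require Import Defs.
From HB Require Import structures.
From mathcomp Require Import all_boot all_order all_algebra.
From mathcomp Require Import finmap.
From mathcomp Require Import all_classical all_reals all_analysis.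
From mathcomp Require Import measurable_realfun.

Set Implicit Arguments.
Unset Strict Implicit.
Unset Printing Implicit Defensive.
Import Order.TTheory GRing.Theory Num.Theory.
Import numFieldNormedType.Exports.
Local Open Scope classical_set_scope.
Local Open Scope ring_scope.
Local Open Scope ereal_scope.

(** A Muller condition on a path depends only on its tail.  Let R be the set of
    states of T2 x M reachable from a BSCC C of the graph on B2.  Since B2 is an
    attractor, R meets B2 exactly in C, so any two states of R reach each other;
    a chain started in R stays there and, C being finite, hits every state of R
    almost surely.  The preimage of R is absorbing for T1 x M because the
    abstraction preserves null sets, and soundness, applied to the law of the
    current state, shows that inside it the preimage of every state of R is
    visited infinitely often.  So once a path of T1 x M has entered the preimage
    of C, its Inf-set is almost surely the projection of R to Q, which belongs to
    F exactly when C is good.  By soundness again some BSCC is entered almost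
    surely, and it is unique because distinct BSCCs have disjoint reachable sets. *)

(** * Conditional laws and integration against a mixture of kernels *)

Lemma mule_inj (R : realFieldType) (x : \bar R) :
  x != 0 -> x \is a fin_num -> injective ( *%E x).
Proof.
move=> x0 xfin y z yz.
by rewrite -[y]mul1e -[z]mul1e -(mulVe x0 xfin) -!muleA yz.
Qed.

Section conditioning.
Context d (T : measurableType d) (R : realType).
Implicit Types (P : probability T R) (E : set T).

Lemma mnormalizeE (m : {measure set T -> \bar R}) P U :
  m setT != 0 -> m setT != +oo ->
  mnormalize m P U = m U * (fine (m setT))^-1%:E.
Proof. by move=> m0 moo; rewrite /mnormalize (negbTE m0) (negbTE moo). Qed.

(** The witness is the normalised restriction of [P] to [E]; the product form spares every later use
    a division in the extended reals. *)
Lemma conditional_probability P E : measurable E -> P E != 0 ->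
  exists P' : probability T R, forall U, measurable U ->
    P (E `&` U) = P E * P' U.
Proof.
move=> mE E0; pose m : {measure set T -> \bar R} := mrestr P mE.
have Efin : P E \is a fin_num by exact: fin_num_measure.
have mU V : m V = P (V `&` E) by [].
(* The argument [P] is only the default of [mnormalize] for a total mass of zero or infinity, which
   [E0] and [Efin] exclude. *)
pose P' : probability T R := mnormalize m P.
have P'E U : P' U = P (U `&` E) * (fine (P E))^-1%:E.
  have := @mnormalizeE m P U; rewrite !mU setTI; apply=> //.
  by apply: contraTN Efin => /eqP ->.
exists P' => U _; rewrite P'E.
rewrite setIC muleCA -{1}(fineK Efin) -EFinM divff ?mule1//.
by rewrite fine_eq0.
Qed.

(** Taking [U] to be the complement of [E] shows that [P'] is carried by [E]; on measurable subsets
    of [E] the measure [P] is [P'] scaled by [P E]. *)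
Lemma ge0_integral_conditional P P' E (f : T -> \bar R) :
  measurable E -> (forall U, measurable U -> P (E `&` U) = P E * P' U) ->
  measurable_fun [set: T] f -> (forall x, 0 <= f x) -> P E != 0 ->
  \int[P]_(x in E) f x = P E * \int[P']_x f x.
Proof.
move=> mE PE mf f0 E0.
have Efin : P E \is a fin_num by exact: fin_num_measure.
have P'E : P' (~` E) = 0.
  have := PE _ (measurableC mE); rewrite setICr measure0 => /esym/eqP.
  by rewrite mule_eq0 (negbTE E0) => /eqP.
rewrite (ge0_negligible_integral (measurableC mE) _ _ _ P'E)//.
rewrite setTD setCK.
have pE : (0 <= fine (P E))%R by rewrite fine_ge0.
rewrite -(fineK Efin) -(@ge0_integral_mscale _ _ _ P' E mE (NngNum pE) f)//;
  last exact: measurable_funS mf.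
apply: eq_measure_integral => A mA AE.
transitivity (P E * P' A); last by rewrite -{1}(fineK Efin).
by rewrite -PE// setIC; congr (P _); apply/esym/setIidPl.
Qed.

Lemma pushforward_probability d' (T' : measurableType d') P (f : T -> T') :
  measurable_fun [set: T] f ->
  exists Q : probability T' R, forall U, Q U = P (f @^-1` U).
Proof.
move=> mf; pose X : {mfun T >-> T'} := mfun_Sub (mem_set mf).
by exists (distribution P X).
Qed.

End conditioning.

Section integral_bind.
Context d (T : measurableType d) (R : realType) (k : R.-pker T ~> T).

(** [integral_kcomp] composes a first kernel with a second one that takes pairs, so [mu] is viewed
    as a kernel from [unit] and [k] is made to ignore its [unit] component. *)
Let ksnd (x : unit * T) : {measure set T -> \bar R} := k x.2.

Let measurable_ksnd U : measurable U ->
  measurable_fun [set: unit * T] (ksnd ^~ U).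
Proof.
move=> mU; exact: (measurableT_comp (measurable_kernel k U mU) measurable_snd).
Qed.

HB.instance Definition _ := isKernel.Build _ _ _ _ R ksnd measurable_ksnd.

Let ksnd1 x : ksnd x [set: T] = 1. Proof. exact: prob_kernel. Qed.

HB.instance Definition _ := Kernel_isProbability.Build _ _ _ _ R ksnd ksnd1.

Lemma ge0_integral_bind (mu nu : probability T R) (f : T -> \bar R) :
  (forall U, measurable U -> nu U = \int[mu]_x k x U) ->
  measurable_fun [set: T] f -> (forall x, 0 <= f x) ->
  \int[nu]_x f x = \int[mu]_x \int[k x]_y f y.
Proof.
move=> nuE mf f0.
pose l := kprobability (@measurable_cst _ _ unit (pprobability T R) setT mu).
rewrite -[RHS](@integral_kcomp _ _ _ unit T T R l ksnd tt f f0 mf).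
apply: eq_measure_integral => A mA _; exact: nuE.
Qed.

End integral_bind.

(** * The Markov property of chain laws *)

Definition shift_run (S : Type) (n : nat) (w : run S) : run S :=
  fun i => w (n + i)%N.

Section chain.
Context d (S : measurableType d) (R : realType) (k : R.-pker S ~> S).

Lemma measurable_shift n : measurable_fun [set: run S] (@shift_run S n).
Proof. by apply: measurable_to_run => i; exact: measurable_coord. Qed.

Lemma measurable_shift_preimage n (A : set (run S)) : measurable A ->
  measurable (@shift_run S n @^-1` A).
Proof. by move=> mA; rewrite -[X in measurable X]setTI; exact: measurable_shift. Qed.

Lemma measurable_coord_preimage n (A : set S) : measurable A ->
  measurable [set w : run S | A (w n)].
Proof. by move=> mA; rewrite -[X in measurable X]setTI; exact: measurable_coord. Qed.

Definition box (n : nat) (A : nat -> set S) : set (run S) :=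
  [set w | forall i, (i <= n)%N -> A i (w i)].

Lemma measurable_box n A : (forall i, measurable (A i)) -> measurable (box n A).
Proof.
move=> mA.
have -> : box n A = \bigcap_(i in `I_n.+1) [set w | A i (w i)].
  by apply/seteqP; split=> w h i /= iN; exact: h.
by apply: bigcap_measurableType => i _; exact: measurable_coord_preimage.
Qed.

Lemma fdd_ge0 n A x : 0 <= fdd k n A x.
Proof.
elim: n A x => [|n IH] A x /=; first by rewrite lee_fin.
by rewrite mule_ge0 ?lee_fin// integral_ge0.
Qed.

Lemma measurable_fdd n A : (forall i, measurable (A i)) ->
  measurable_fun [set: S] (fdd k n A).
Proof.
elim: n A => [|n IH] A mA /=; first by apply/measurable_EFinP.
apply: emeasurable_funM; first by apply/measurable_EFinP.
apply: measurable_fun_integral_kernel; last exact: IH.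
- by move=> U mU; exact: measurable_kernel.
- by move=> z; exact: fdd_ge0.
Qed.

(** The conditional law of the path given that it starts in [E] satisfies the finite-dimensional
    equations of the chain started from [nu], and these determine the law. *)
Lemma chain_law_conditional (mu nu : probability S R) E (A : set (run S)) :
  measurable E -> mu E != 0 -> measurable A ->
  (forall U, measurable U -> mu (E `&` U) = mu E * nu U) ->
  chain_law k mu ([set w | E (w 0%N)] `&` A) = mu E * chain_law k nu A.
Proof.
move=> mE E0 mA nuE; set P := chain_law k mu; set F : set (run S) := [set w | _].
have mF : measurable F by exact: measurable_coord_preimage.
have Efin : mu E \is a fin_num by exact: fin_num_measure.
have PF : P F = mu E.
  rewrite (_ : F = box 0 (fun=> E)); last first.
    by apply/seteqP; split=> [w h [|//] _ //|w h]; exact: (h 0%N isT).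
  rewrite /P (chain_lawP k mu)//.
  by rewrite integral_indic// setIT.
have [P' P'E] : exists P' : probability (run S) R, forall U, measurable U ->
    P (F `&` U) = P F * P' U.
  by apply: conditional_probability; rewrite ?PF.
rewrite P'E// PF; congr (_ * _).
apply: (chain_law_unique (k := k) (mu := nu)) mA; last exact: chain_lawP.
move=> n C mC; apply: (@mule_inj _ (mu E)) => //.
(* After multiplication by [mu E], the condition on the initial state is absorbed into the first
   factor of the box, so the equation for [mu] applies. *)
have mC' : forall i, measurable (if i == 0%N then E `&` C 0%N else C i).
  by case=> [|i] //=; exact: measurableI.
rewrite -(ge0_integral_conditional mE nuE)//; last 2 first.
- exact: measurable_fdd.
- by move=> x; exact: fdd_ge0.
rewrite -PF -P'E; last exact: measurable_box.
rewrite (_ : F `&` _ = box n (fun i => if i == 0%N then E `&` C 0%N else C i)).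
  rewrite /P (chain_lawP k mu)// [RHS]integral_mkcond; apply: eq_integral => x _.
  rewrite patchE; case: n => [|n] /=; case: ifPn => xE.
  - by rewrite indicE in_setI xE.
  - by rewrite indicE in_setI (negbTE xE).
  - by rewrite indicE in_setI xE indicE.
  - by rewrite indicE in_setI (negbTE xE) mul0e.
apply/seteqP; split=> w.
  by move=> [Ew h] [|i] iN /=; [split=> //; exact: h|exact: h].
move=> h; split; first by have [] := h 0%N isT.
by case=> [|i] iN; [have [] := h 0%N isT|exact: (h i.+1)].
Qed.

Lemma chain_law_coord1 (mu : probability S R) U : measurable U ->
  chain_law k mu [set w | U (w 1%N)] = \int[mu]_x k x U.
Proof.
move=> mU; rewrite (_ : [set w : run S | U (w 1%N)] =
  box 1 (fun i => if i == 1%N then U else setT)); last first.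
  by apply/seteqP; split=> [w Uw [|[|//]] //|w h]; exact: (h 1%N isT).
rewrite (chain_lawP k mu)//; last by move=> i; case: ifP.
apply: eq_integral => x _ /=.
by rewrite indicT mul1e integral_indic// setIT.
Qed.

(** With [nu] the law of the state at time 1, the shifted path satisfies the finite-dimensional
    equations for [nu], and uniqueness concludes. *)
Lemma chain_law_shift1 (mu : probability S R) : exists2 nu : probability S R,
  (forall U, measurable U -> nu U = \int[mu]_x k x U) &
  forall A : set (run S), measurable A ->
    chain_law k mu (shift_run 1 @^-1` A) = chain_law k nu A.
Proof.
have [nu nuE] := pushforward_probability (chain_law k mu)
  (@measurable_coord _ S 1).
exists nu => [U mU|A mA]; first by rewrite nuE chain_law_coord1.
have [P PE] := pushforward_probability (chain_law k mu) (measurable_shift 1).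
rewrite -PE; apply: (chain_law_unique (k := k) (mu := nu)) mA; last first.
  exact: chain_lawP.
move=> n C mC; rewrite PE.
rewrite (@ge0_integral_bind _ _ _ k mu)//; last 3 first.
- by move=> U mU; rewrite nuE chain_law_coord1.
- exact: measurable_fdd.
- by move=> x; exact: fdd_ge0.
(* A shifted box is a box one step longer, unconstrained at time 0; one unfolding of [fdd] then
   yields the inner integral against [k]. *)
rewrite (_ : _ @^-1` _ = box n.+1 (fun i => if i is j.+1 then C j else setT)).
  rewrite (chain_lawP k mu)//; last by case.
  by apply: eq_integral => x _ /=; rewrite indicT mul1e.
apply/seteqP; split=> w h; first by case=> [//|i] iN; exact: h.
by move=> i iN; exact: (h i.+1).
Qed.

Lemma chain_law_coord0 (mu : probability S R) U : measurable U ->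
  chain_law k mu [set w | U (w 0%N)] = mu U.
Proof.
move=> mU; rewrite (_ : [set w : run S | U (w 0%N)] = box 0 (fun=> U)).
  by rewrite (chain_lawP k mu)// integral_indic// setIT.
by apply/seteqP; split=> [w h [|//] _ //|w h]; exact: (h 0%N isT).
Qed.

(** Here [nu] plays the role of the law of the state at time n given the box. The induction peels
    off time 0: condition the initial law on [E 0], shift by one step, and recurse on the remaining
    box. *)
Lemma chain_law_markov (mu : probability S R) n (E : nat -> set S) :
  (forall i, measurable (E i)) -> chain_law k mu (box n E) != 0 ->
  exists nu : probability S R, forall A : set (run S), measurable A ->
    chain_law k mu (box n E `&` shift_run n @^-1` A) =
    chain_law k mu (box n E) * chain_law k nu A.
Proof.
have boxS m (F : nat -> set S) :
    box m.+1 F =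
    [set w | F 0%N (w 0%N)] `&` shift_run 1 @^-1` box m (fun i => F i.+1).
  apply/seteqP; split=> w; first by move=> h; split=> [|i iN]; exact: h.
  by move=> [F0 h] [|i] iN //; exact: h.
elim: n mu E => [|n IH] mu E mE.
  have -> : box 0 E = [set w | E 0%N (w 0%N)].
    by apply/seteqP; split=> [w h|w h [|//] _ //]; exact: (h 0%N isT).
  rewrite chain_law_coord0// => E0.
  have [nu nuE] := conditional_probability (mE 0%N) E0.
  by exists nu => A mA; rewrite -chain_law_conditional.
rewrite boxS => bn0.
have E0 : mu (E 0%N) != 0.
  apply: contra_neq bn0 => E0; apply/eqP; rewrite -measure_le0.
  rewrite -E0 -chain_law_coord0// le_measure ?inE//.
  - apply: measurableI; first exact: measurable_coord_preimage.
    by apply: measurable_shift_preimage; exact: measurable_box.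
  - exact: measurable_coord_preimage.
have [nu nuE] := conditional_probability (mE 0%N) E0.
have [nu1 _ nu1E] := chain_law_shift1 nu.
have mb : measurable (box n (fun i => E i.+1)) by exact: measurable_box.
have bE : chain_law k mu
    ([set w | E 0%N (w 0%N)] `&` shift_run 1 @^-1` box n (fun i => E i.+1)) =
    mu (E 0%N) * chain_law k nu1 (box n (fun i => E i.+1)).
  rewrite (chain_law_conditional _ _ _ nuE)// ?nu1E//.
  exact: measurable_shift_preimage.
have [|nu2 nu2E] := IH nu1 (fun i => E i.+1) (fun i => mE i.+1).
  by apply: contra_neq bn0 => b0; rewrite bE b0 mule0.
exists nu2 => A mA.
rewrite bE -muleA -nu2E// -setIA.
have -> : @shift_run S n.+1 @^-1` A = shift_run 1 @^-1` (shift_run n @^-1` A) by [].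
rewrite -preimage_setI (chain_law_conditional _ _ _ nuE)// ?nu1E//.
- by apply: measurableI => //; exact: measurable_shift_preimage.
- apply: measurable_shift_preimage; apply: measurableI => //.
  exact: measurable_shift_preimage.
Qed.

End chain.

(** * Hitting and absorption for general chains *)

Lemma partition_bound d (T : measurableType d) (R : realType)
    (P : probability T R) (E : nat -> set T) (N : set T) (r : R) :
  (forall i, measurable (E i)) -> trivIset setT E -> P (\bigcup_i E i) = 1 ->
  measurable N -> (forall i, P (E i `&` N) <= r%:E * P (E i)) -> P N <= r%:E.
Proof.
move=> mE tE E1 mN EN.
have mU : measurable (\bigcup_i E i) by exact: bigcup_measurable.
(* The part of [N] outside the cells is null; the cellwise bounds are then summed, the masses of the
   cells adding up to 1. *)
have U0 : P (N `\` \bigcup_i E i) = 0.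
  apply/eqP; rewrite -measure_le0; apply: (@le_trans _ _ (P (~` \bigcup_i E i))).
    rewrite le_measure ?inE//; [exact: measurableD|exact: measurableC].
  by rewrite probability_setC// E1 subee.
have -> : P N = P (N `\` \bigcup_i E i) + P (N `&` \bigcup_i E i).
  exact: measureDI.
rewrite U0 add0e setI_bigcupr measure_bigcup//; last 2 first.
- by move=> i _; exact: measurableI.
- exact: trivIset_setIl.
have -> : r%:E = r%:E * \sum_(i <oo | i \in setT) P (E i).
  by rewrite -[\sum_(_ <oo | _) _](measure_bigcup P)// [X in _ * X]E1 mule1.
rewrite -nneseriesZl//; apply: lee_nneseries => // i _.
by rewrite setIC EN.
Qed.

Section hitting.
Context d (S : measurableType d) (R : realType) (k : R.-pker S ~> S).
Implicit Types (mu nu : probability S R).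

Lemma measurable_eventually_in (A : set S) : measurable A ->
  measurable (eventually_in A).
Proof.
move=> mA; rewrite (_ : eventually_in A = \bigcup_i [set w | A (w i)]).
  by apply: bigcup_measurable => i _; exact: measurable_coord_preimage.
by apply/seteqP; split=> w [i]; [exists i|exists i].
Qed.

Lemma eq_chain_law mu nu (A : set (run S)) :
  (forall U, measurable U -> mu U = nu U) -> measurable A ->
  chain_law k mu A = chain_law k nu A.
Proof.
move=> munu mA; apply: (chain_law_unique (k := k) (mu := mu)) mA.
  exact: chain_lawP.
move=> n C mC; rewrite (chain_lawP k nu)//.
by apply: eq_measure_integral => U mU _; exact: esym (munu U mU).
Qed.

(** Conditioning [mu] on a single point gives the Dirac measure there; if the point has mass zero,
    both sides vanish. *)
Lemma chain_law_point mu y (A : set (run S)) : measurable [set y] ->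
  measurable A ->
  chain_law k mu ([set w | w 0%N = y] `&` A) =
  mu [set y] * chain_law k (dirac y) A.
Proof.
move=> my mA; have [y0|y0] := eqVneq (mu [set y]) 0.
  rewrite y0 mul0e; apply/eqP; rewrite -measure_le0 -y0 -(chain_law_coord0 k)//.
  have m0 := measurable_coord_preimage 0 my.
  by rewrite le_measure ?inE//; exact: measurableI.
have [nu nuE] := conditional_probability my y0.
rewrite (chain_law_conditional k my y0 mA nuE); congr (_ * _).
apply: eq_chain_law => // U mU.
have yfin : mu [set y] \is a fin_num by exact: fin_num_measure.
apply: (mule_inj y0 yfin); rewrite -nuE// [X in _ = _ * X]diracE.
have [/set_mem Uy|/negP Uy] := boolP (y \in U).
  by rewrite mule1; congr (mu _); apply/setIidPl => _ ->.
rewrite mule0 (_ : _ `&` _ = set0) ?measure0//.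
by apply/seteqP; split=> // _ [-> /mem_set].
Qed.

(** The law given by the Markov property is known only through its product formula; testing that
    formula on an event about time 0 reads off its null sets. *)
Lemma markov_support mu nu n (E : nat -> set S) Z :
  (forall i, measurable (E i)) -> chain_law k mu (box n E) != 0 ->
  (forall A : set (run S), measurable A ->
    chain_law k mu (box n E `&` shift_run n @^-1` A) =
    chain_law k mu (box n E) * chain_law k nu A) ->
  measurable Z -> chain_law k mu (box n E `&` [set w | Z (w n)]) = 0 ->
  nu Z = 0.
Proof.
move=> mE b0 nuE mZ Z0.
have mZ0 := measurable_coord_preimage 0 mZ.
have := nuE _ mZ0; rewrite chain_law_coord0//.
rewrite (_ : _ `&` _ = box n E `&` [set w | Z (w n)]); last first.
  by congr (_ `&` _); apply/funext => w; rewrite /= /shift_run addn0.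
by rewrite Z0 => /esym/eqP; rewrite mule_eq0 (negbTE b0) => /eqP.
Qed.

(** Given a visit to [E] at time n, the path from then on is a chain whose initial law is carried by
    [E], to which the hypothesis applies. *)
Lemma chain_law_visit mu n E (A : set (run S)) : measurable E -> measurable A ->
  (forall nu, nu (~` E) = 0 -> chain_law k nu A = 0) ->
  chain_law k mu ([set w | E (w n)] `&` shift_run n @^-1` A) = 0.
Proof.
(* A box constrained at time n only, so that the Markov property applies. *)
move=> mE mA h; pose F i := if i == n then E else setT.
have mF i : measurable (F i) by rewrite /F; case: ifP.
have -> : [set w : run S | E (w n)] = box n F.
  apply/seteqP; split=> w; last by move=> /(_ n (leqnn n)); rewrite /F eqxx.
  by move=> Ew i _; rewrite /F; case: eqP => // ->.
have mb := measurable_box n mF.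
have mSA := measurable_shift_preimage n mA.
have [b0|b0] := eqVneq (chain_law k mu (box n F)) 0.
  apply/eqP; rewrite -measure_le0 -b0.
  by rewrite le_measure ?inE//; exact: measurableI.
have [nu nuE] := chain_law_markov (k := k) mF b0.
rewrite nuE// h ?mule0//.
apply: (markov_support mF b0 nuE); first exact: measurableC.
rewrite (_ : _ `&` _ = set0) ?measure0//.
by apply/seteqP; split=> // w [/(_ n (leqnn n))]; rewrite /F eqxx.
Qed.

(** Phrased with null sets of laws instead of pointwise, because an abstraction preserves exactly
    the null sets of one-step images of laws. *)
Definition absorbing (Z : set S) := forall nu,
  nu (~` Z) = 0 -> \int[nu]_x k x (~` Z) = 0.

Lemma absorbing_coord Z nu n : measurable Z -> absorbing Z -> nu (~` Z) = 0 ->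
  chain_law k nu [set w | ~ Z (w n)] = 0.
Proof.
move=> mZ aZ; elim: n nu => [|n IH] nu Z0.
  by rewrite (chain_law_coord0 k nu (measurableC mZ)).
have [nu1 nu1E shiftE] := chain_law_shift1 k nu.
have := shiftE _ (measurable_coord_preimage n (measurableC mZ)).
rewrite (IH nu1) => [//|]; rewrite nu1E; [exact: aZ|exact: measurableC].
Qed.
End hitting.

(** * Almost sure hitting in denumerable chains *)

Lemma finite_seq_bound (T : eqType) (R : realType) (f : T -> R) (s : seq T) :
  {in s, forall x, f x < 1}%R ->
  exists2 r : R, (r < 1)%R & {in s, forall x, f x <= r}%R.
Proof.
elim: s => [|x s IH] h; first by exists 0%R.
have [|r r1 rs] := IH; first by move=> y ys; apply: h; rewrite inE ys orbT.
exists (Num.max (f x) r); first by rewrite gt_max h ?mem_head.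
move=> y; rewrite inE le_max => /predU1P[->|/rs ->]; [by rewrite lexx|exact: orbT].
Qed.

Lemma denumerable_injection d (S : measurableType d) :
  denumerable_chain S -> exists g : S -> nat, injective g.
Proof.
move=> [/countable_injP[g gI] _]; exists g => x y.
by apply: gI; rewrite inE.
Qed.

Section hitting_countable.
Context d (S : measurableType d) (R : realType) (k : R.-pker S ~> S).
Implicit Types (mu nu : probability S R).

Hypothesis dS : denumerable_chain S.

Let mS (A : set S) : measurable A. Proof. exact: dS.2. Qed.

(** The path space is partitioned by the initial state, numbered through the injection [g]; states
    outside [D] have mass zero, so the bound from Dirac starts in [D] suffices. *)
Lemma chain_law_dirac_bound mu D (N : set (run S)) (r : R) :
  measurable N -> mu (~` D) = 0 ->
  (forall y, D y -> chain_law k (dirac y) N <= r%:E) ->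
  chain_law k mu N <= r%:E.
Proof.
move=> mN D0 Nr.
have [g gI] := denumerable_injection dS.
pose E i : set (run S) := [set w | g (w 0%N) = i].
have mE i : measurable (E i).
  exact: (measurable_coord_preimage 0 (mS [set y | g y = i])).
apply: (partition_bound (E := E)) => //.
- apply/trivIsetP => i j _ _ /eqP ij; apply/seteqP; split=> // w [wi wj].
  by apply: ij; rewrite -wi -wj.
- rewrite (_ : \bigcup_i E i = setT) ?probability_setT//.
  by apply/seteqP; split=> // w _; exists (g (w 0%N)).
- move=> i; have [[y gy]|noy] := pselect (exists y, g y = i); last first.
    rewrite (_ : E i = set0) ?set0I ?measure0 ?mule0//.
    by apply/seteqP; split=> // w Ew; apply: noy; exists (w 0%N).
  have -> : E i = [set w | w 0%N = y].
    by apply/seteqP; split=> w; rewrite /E /= -gy; [exact: gI|move=> ->].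
  rewrite chain_law_point// (chain_law_coord0 k mu (mS [set y])) muleC.
  have [Dy|Dy] := pselect (D y); first by apply: lee_wpmul2r => //; exact: Nr.
  suff -> : mu [set y] = 0 by rewrite !mule0.
  apply/eqP; rewrite -measure_le0 -D0 le_measure ?inE//.
  by move=> _ ->.
Qed.

(* Splits according to the first visit to B, whose time is n on box n E. *)
Lemma chain_law_first_hit mu (B : set S) (N : set (run S)) (r : R) :
  measurable N -> chain_law k mu (eventually_in B) = 1 ->
  (forall n, N `<=` shift_run n @^-1` N) ->
  (forall nu (n : nat) (E := fun i => if i == n then B else ~` B),
   chain_law k mu (box n E) != 0 ->
   (forall A : set (run S), measurable A ->
    chain_law k mu (box n E `&` shift_run n @^-1` A) =
    chain_law k mu (box n E) * chain_law k nu A) -> chain_law k nu N <= r%:E) ->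
  chain_law k mu N <= r%:E.
Proof.
move=> mN FB Nshift h.
pose E (n i : nat) := if i == n then B else ~` B.
have mb n : measurable (box n (E n)) by exact: measurable_box.
apply: (partition_bound (E := fun n => box n (E n))) => //.
- apply/trivIsetP => i j _ _ ij; apply/seteqP; split=> // w [wi wj].
  wlog ltij : i j {ij} wi wj / (i < j)%N.
    move=> H; move: ij; rewrite neq_ltn => /orP[]; exact: H.
  have := wi i (leqnn i); rewrite /E eqxx => Bw.
  by have := wj i (ltnW ltij); rewrite /E (ltn_eqF ltij).
- rewrite (_ : \bigcup_i _ = eventually_in B)//; apply/seteqP; split=> w.
    by move=> [n _ /(_ n (leqnn n))]; rewrite /E eqxx => Bw; exists n.
  move=> Bw; have exB : exists n, `[< B (w n) >].
    by case: Bw => n Bn; exists n; apply/asboolP.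
  case: (ex_minnP exB) => n /asboolP Bn minn; exists n => // i iN.
  rewrite /E; case: eqP => [->//|/eqP ni] Bi.
  have /minn : `[< B (w i) >] by apply/asboolP.
  by rewrite leqNgt ltn_neqAle ni iN.
- move=> n; have mSN := measurable_shift_preimage n mN.
  have [b0|b0] := eqVneq (chain_law k mu (box n (E n))) 0.
    rewrite b0 mule0 -b0 le_measure ?inE//; exact: measurableI.
  have [nu nuE] := chain_law_markov (k := k) (fun i => mS (E n i)) b0.
  apply: (@le_trans _ _ (chain_law k mu (box n (E n) `&` shift_run n @^-1` N))).
    rewrite le_measure ?inE//; [exact: measurableI|exact: measurableI|].
    by move=> w [bw /(Nshift n)].
  rewrite nuE// muleC; apply: lee_wpmul2r => //.
  exact: h b0 nuE.
Qed.

Definition avoid (A : set S) : set (run S) := ~` eventually_in A.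

Lemma avoid_shift A n : avoid A `<=` shift_run n @^-1` avoid A.
Proof. by move=> w Nw [i Ai]; apply: Nw; exists (n + i)%N. Qed.

Lemma measurable_avoid A : measurable (avoid A).
Proof. by apply: measurableC; exact: measurable_eventually_in. Qed.

(* The Markov property at time n gives P(avoid A) <= r P(no visit up to n);
   letting n grow, P(avoid A) <= r P(avoid A) with r < 1. *)
Lemma chain_law_uniform mu (Z A : set S) (r : R) :
  absorbing k Z -> mu (~` Z) = 0 -> (r < 1)%R ->
  (forall nu, nu (~` Z) = 0 -> chain_law k nu (avoid A) <= r%:E) ->
  chain_law k mu (avoid A) = 0.
Proof.
move=> aZ Z0 r1 Nr.
have mN := measurable_avoid A.
have PNfin : chain_law k mu (avoid A) \is a fin_num by exact: fin_num_measure.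
pose F n := box n (fun=> ~` A).
have mF n : measurable (F n) by exact: measurable_box.
have NF n : chain_law k mu (avoid A) <= r%:E * chain_law k mu (F n).
  have mSN := measurable_shift_preimage n mN.
  have sub : avoid A `<=` F n `&` shift_run n @^-1` avoid A.
    move=> w Nw; split; last exact: avoid_shift.
    by move=> i _ Ai; apply: Nw; exists i.
  apply: (le_trans (le_measure _ _ _ sub)); rewrite ?inE//; first exact: measurableI.
  move: {sub} (mF n); rewrite /F => mb.
  have [b0|b0] := eqVneq (chain_law k mu (box n (fun=> ~` A))) 0.
    by rewrite b0 mule0 -b0 le_measure ?inE//; exact: measurableI.
  have [nu nuE] := chain_law_markov (k := k) (fun=> mS (~` A)) b0.
  rewrite [leLHS](nuE _ mN) muleC; apply: lee_wpmul2r => //; apply: Nr.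
  apply: (markov_support (fun=> mS (~` A)) b0 nuE) => //.
  apply/eqP; rewrite -measure_le0 -(absorbing_coord n (mS Z) aZ Z0).
  by rewrite le_measure ?inE//; [apply: measurableI => //|];
    exact: (measurable_coord_preimage n (mS (~` Z))).
have cvF : chain_law k mu (F n) @[n --> \oo] --> chain_law k mu (avoid A).
  rewrite (_ : avoid A = \bigcap_n F n); last first.
    apply/seteqP; split=> w; first by move=> Nw n _ i _ Ai; apply: Nw; exists i.
    by move=> h [i Ai]; exact: (h i I i (leqnn i)).
  apply: nonincreasing_cvg_mu => //.
  - by rewrite -ge0_fin_numE// fin_num_measure.
  - exact: bigcap_measurableType.
  - by move=> m n mn; apply/subsetPset => w Fw i im; apply: Fw; exact: leq_trans mn.
have le1 : chain_law k mu (avoid A) <= r%:E * chain_law k mu (avoid A).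
  apply: (@cvge_ge _ \oo _ _ (fun n => r%:E * chain_law k mu (F n))).
    by apply: nearW => n; exact: NF.
  by apply: cvgeZl.
move: le1; rewrite -(fineK PNfin) -EFinM lee_fin => le1.
congr EFin; apply/eqP; rewrite eq_le fine_ge0// andbT.
by rewrite leNgt; apply/negP => p0; move: le1; rewrite leNgt gtr_pMl// r1.
Qed.

(** From every start in [Z] the chain first enters [B] at a state of [Z]. As [B] is finite, the
    probabilities of avoiding [A] from such states have a common bound below 1, which
    [chain_law_uniform] improves to 0. *)
Lemma attractor_hits mu (B Z A : set S) : finite_set B ->
  (forall nu, chain_law k nu (eventually_in B) = 1) ->
  absorbing k Z -> mu (~` Z) = 0 ->
  (forall b, B b -> Z b -> chain_law k (dirac b) (eventually_in A) != 0) ->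
  chain_law k mu (eventually_in A) = 1.
Proof.
move=> finB FB aZ Z0 hit.
have [s sE] := (finite_seqP _).1 finB.
have avoidE b : chain_law k (dirac b) (avoid A) =
    1 - chain_law k (dirac b) (eventually_in A).
  by rewrite probability_setC//; exact: measurable_eventually_in.
have finN nu : chain_law k nu (avoid A) \is a fin_num.
  by rewrite fin_num_measure//; exact: measurable_avoid.
(* Nothing is known about states outside [Z]; the value 0 keeps [f] below 1 there. *)
pose f b := if `[< Z b >] then fine (chain_law k (dirac b) (avoid A)) else 0%R.
have [b bs|r r1 fr] := @finite_seq_bound S R f s.
  rewrite /f; case: asboolP => // Zb; rewrite -lte_fin fineK// avoidE.
  rewrite lte_subel_addr// ?fin_num_measure//.
  rewrite -[ltLHS]adde0 lteD2lE// lt0e measure_ge0 andbT.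
  by apply: hit => //; rewrite sE.
have mN := measurable_avoid A.
suff N0 : chain_law k mu (avoid A) = 0.
  rewrite -[eventually_in A]setCK probability_setC//.
  by rewrite [X in _ - X]N0 sube0.
apply: (chain_law_uniform aZ Z0 r1) => nu nuZ.
apply: (chain_law_first_hit (B := B)) => //.
  exact: avoid_shift.
move=> nu' n E b0 nu'E.
have mE i : measurable (E i) by [].
(* At the hitting time the path lies in [B] and, by absorption, almost surely in [Z]; both facts
   pass to [nu']. *)
have supp W : chain_law k nu (box n E `&` [set w | W (w n)]) = 0 -> nu' W = 0.
  exact: (markov_support mE b0 nu'E (mS W)).
apply: (chain_law_dirac_bound (D := B `&` Z)) => // [|b [Bb Zb]].
  have B0 : nu' (~` B) = 0.
    apply: supp; rewrite (_ : _ `&` _ = set0) ?measure0//.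
    by apply/seteqP; split=> // w [/(_ n (leqnn n))]; rewrite /E eqxx.
  have Z0' : nu' (~` Z) = 0.
    apply: supp; apply/eqP; rewrite -measure_le0 -(absorbing_coord n (mS Z) aZ nuZ).
    have mnZ := measurable_coord_preimage n (mS (~` Z)).
    rewrite le_measure ?inE//; apply: measurableI => //; exact: measurable_box.
  rewrite setCI; apply/eqP; rewrite -measure_le0.
  apply: (le_trans (measureU2 _ _ _)) => //.
  by rewrite [X in X + _]B0 [X in _ + X]Z0' adde0.
have bs : b \in s by move: Bb; rewrite sE.
by have := fr b bs; rewrite /f asboolT// -lee_fin fineK.
Qed.

End hitting_countable.

(** * Reachability and bottom components of a graph *)

Lemma reach_refl (V : Type) (e : rel V) x : reach e x x.
Proof. by exists [::]. Qed.

Lemma reach_trans (V : Type) (e : rel V) y x z :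
  reach e x y -> reach e y z -> reach e x z.
Proof.
by move=> [p px <-] [q qx <-]; exists (p ++ q); rewrite ?last_cat// cat_path px.
Qed.

Section reach_theory.
Context (V : choiceType) (e : rel V).
Variable (B : set V).

Let gr : rel V := fun x y => `[< [/\ B x, B y & reach e x y] >].

(** An edge of [gr] already stands for a whole path of [e], so one edge suffices in one direction
    and transitivity in the other. *)
Lemma reach_graph x y : B x -> B y -> reach gr x y <-> reach e x y.
Proof.
move=> Bx By; split=> [[p + <-]|xy]; last first.
  by exists [:: y] => //=; rewrite andbT; apply/asboolP.
elim: p x {Bx By} => [|z p IH] x /=; first by move=> _; exact: reach_refl.
by move=> /andP[/asboolP[_ _ xz] /IH]; exact: reach_trans.
Qed.

(** Being bottom constrains single edges, but these are reachability itself, so the component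
    contains all of [B] that [x] reaches; conversely, a way back to [x] makes that set a class of
    mutual reachability. *)
Lemma bsccP (C : set V) : bscc B gr C <->
  exists x, [/\ B x, C = B `&` reach e x & forall y, C y -> reach e y x].
Proof.
split=> [[[x Bx CE] bot]|[x [Bx CE back]]].
  have Cx : C x by rewrite CE; split=> //; exact: reach_refl.
  exists x; split=> //; last first.
    by move=> y; rewrite CE => -[By _ /reach_graph]; exact.
  apply/seteqP; split=> y.
    by rewrite CE => -[By /reach_graph xy _]; split=> //; exact: xy.
  by move=> [By xy]; apply: (bot x y) => //; apply/asboolP.
split.
  exists x => //; apply/seteqP; split=> y.
    move=> Cy; have := back y Cy; move: Cy; rewrite CE => -[By xy] yx.
    by split=> //; apply/reach_graph.
  by move=> [By /(reach_graph Bx By) xy _]; rewrite CE.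
move=> y z; rewrite CE => -[_ xy] Bz /asboolP[_ _ yz].
by split=> //; exact: reach_trans yz.
Qed.

Lemma bscc_reachable b : finite_set B -> B b ->
  exists C c, [/\ bscc B gr C, C c & reach e b c].
Proof.
(* If some reachable y of B cannot come back to b, it reaches fewer states of B. *)
move=> finB; have := leqnn #|` fset_set (B `&` reach e b)|.
move: {2}(#|` fset_set (B `&` reach e b)|) => n.
elim: n b => [|n IH] b.
  rewrite leqn0 cardfs_eq0 => /eqP /fset_set_set0 h Bb.
  have : (B `&` reach e b) b by split=> //; exact: reach_refl.
  by rewrite h//; exact: finite_setIl.
move=> bn Bb; have [back|] := pselect (forall y, (B `&` reach e b) y -> reach e y b).
  exists (B `&` reach e b), b; split;
    [|by split=> //; exact: reach_refl|exact: reach_refl].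
  by apply/bsccP; exists b.
move=> /existsNP[y /not_implyP[[By byr] nyb]].
have [|//|C [c [bC Cc yc]]] := IH y; last first.
  by exists C, c; split=> //; exact: reach_trans yc.
rewrite -ltnS; apply: leq_trans bn; apply: fproper_ltn_card.
have finr z : finite_set (B `&` reach e z) by exact: finite_setIl.
rewrite /fproper; apply/andP; split; first apply/fsubsetP => z.
  rewrite !in_fset_set// => /set_mem[Bz yz]; apply/mem_set; split=> //.
  exact: reach_trans yz.
apply/negP => /fsubsetP /(_ b); rewrite !in_fset_set// => h.
by have /set_mem[] := h (mem_set (conj Bb (reach_refl e b))).
Qed.

End reach_theory.

(** * Reachability and probability in a denumerable chain *)

Section reach_chain.
Context (R : realType) (AP : finType) d (S : measurableType d) (T : lsts R AP S).
Implicit Types (mu nu : probability S R).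
Local Notation "x ~~> y" := (reach (step T) x y) (at level 70).

Hypothesis dS : denumerable_chain S.

Let mS (A : set S) : measurable A. Proof. exact: dS.2. Qed.

Lemma countable_null (m : {measure set S -> \bar R}) (A : set S) :
  (forall y, A y -> m [set y] = 0) -> m A = 0.
Proof.
move=> A0; have [g gI] := denumerable_injection dS.
apply: measure_negligible => //.
rewrite (_ : A = \bigcup_i (A `&` [set y | g y = i])); last first.
  by apply/seteqP; split=> y; [exists (g y)|move=> [i _ []]].
apply: negligible_bigcup => i.
have [[y [Ay gy]]|no] := pselect (exists y, A y /\ g y = i).
  exists [set y]; split=> //; first exact: A0.
  by move=> z [Az gz]; apply: gI; rewrite gy.
rewrite (_ : _ `&` _ = set0); first exact: negligible_set0.
by apply/seteqP; split=> // y [Ay gy]; apply: no; exists y.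
Qed.

(** A one-step law from a reachable state that charged a state outside would give an edge to it; by
    countability, the outside is then null as a whole. *)
Lemma reach_absorbing x : absorbing (trans T) (reach (step T) x).
Proof.
move=> nu nu0; set Z := reach _ _.
rewrite (ge0_negligible_integral (mS (~` Z)) _ _ _ nu0)//.
rewrite setTD setCK; apply: integral0_eq => y Zy.
apply: countable_null => z nZz; apply/eqP; rewrite -measure_le0 leNgt.
apply/negP => yz; apply: nZz; apply: (reach_trans Zy).
by exists [:: z] => //=; rewrite andbT; apply/asboolP.
Qed.

(** By induction on the path, the hitting probability is at least that of the first edge times the
    hitting probability from its endpoint, both nonzero. *)
Lemma reach_hits (A : set S) x y : x ~~> y -> A y ->
  chain_law (trans T) (dirac x) (eventually_in A) != 0.
Proof.
move=> [p + <-]; have mF := measurable_eventually_in (mS A).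
elim: p x => [|z p IH] x /=.
  move=> _ Ax; rewrite gt_eqF//.
  apply: (@lt_le_trans _ _ (chain_law (trans T) (dirac x) [set w | A (w 0%N)])).
    by rewrite (chain_law_coord0 _ _ (mS A)) [ltRHS]diracE mem_set.
  rewrite le_measure ?inE//; first exact: measurable_coord_preimage.
  by move=> w Aw; exists 0%N.
move=> /andP[/asboolP xz pz] Al.
have [nu nuE shiftE] := chain_law_shift1 (trans T) (dirac x).
have nuz : nu [set z] != 0.
  rewrite nuE// integral_dirac//.
  by rewrite diracT mul1e gt_eqF.
have m0 : measurable [set w : run S | w 0%N = z].
  exact: (measurable_coord_preimage 0 (mS [set z])).
rewrite gt_eqF//; apply: (@lt_le_trans _ _ (nu [set z] *
    chain_law (trans T) (dirac z) (eventually_in A))).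
  by rewrite lt0e mule_eq0 negb_or nuz (IH _ pz Al) mule_ge0.
rewrite -chain_law_point//.
apply: (@le_trans _ _ (chain_law (trans T) nu (eventually_in A))).
  by rewrite le_measure ?inE//; exact: measurableI.
rewrite -shiftE// le_measure ?inE//; first exact: measurable_shift_preimage.
by move=> w [i Ai]; exists (1 + i)%N.
Qed.

Lemma attractor_reachable (B : set S) x : attractor T B ->
  exists2 b, B b & x ~~> b.
Proof.
move=> [_ FB]; apply: contrapT => noB; set Z := reach (step T) x.
have Z0 : (dirac x : probability S R) (~` Z) = 0.
  by rewrite [LHS]diracE memNset//; apply; exact: reach_refl.
suff : Prob T (dirac x) (eventually_in B) = 0.
  by rewrite FB => /eqP; rewrite onee_eq0.
apply: measure_negligible; first exact: measurable_eventually_in.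
(* If no state of [B] is reachable, a visit to [B] at time n puts the path outside the absorbing set
   [Z] at that time. *)
apply: (negligibleS (A := \bigcup_n [set w : run S | ~ Z (w n)])).
  by move=> w [n Bn]; exists n => // Zn; apply: noB; exists (w n).
apply: negligible_bigcup => n; apply/negligibleP.
  exact: (measurable_coord_preimage n (mS (~` Z))).
exact: (absorbing_coord n (mS Z) (@reach_absorbing x) Z0).
Qed.

End reach_chain.

(** * Almost sure properties of [T1] inherited from [T2] *)

Lemma ae_mono d (T : measurableType d) (R : realType) (P : probability T R)
    (Q1 Q2 : T -> Prop) : (forall w, Q1 w -> Q2 w) ->
  {ae P, forall w, Q1 w} -> {ae P, forall w, Q2 w}.
Proof. by move=> Q12; apply: filterS. Qed.

Lemma ae_and d (T : measurableType d) (R : realType) (P : probability T R)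
    (Q1 Q2 : T -> Prop) :
  {ae P, forall w, Q1 w} -> {ae P, forall w, Q2 w} ->
  {ae P, forall w, Q1 w /\ Q2 w}.
Proof. exact: filterI. Qed.

(** Numbering [Y] by an injection turns the quantifier over states into one over integers, through
    which [ae] passes. *)
Lemma ae_forall_denumerable d (Y : measurableType d) d' (T : measurableType d')
    (R : realType) (P : probability T R) (Q : Y -> T -> Prop) :
  denumerable_chain Y -> (forall y, {ae P, forall w, Q y w}) ->
  {ae P, forall w, forall y, Q y w}.
Proof.
move=> dY Qae; have [g gI] := denumerable_injection dY.
have : {ae P, forall w, forall i y, g y = i -> Q y w}.
  apply: ae_foralln => i; have [[y gy]|no] := pselect (exists y, g y = i).
    apply: filterS (Qae y) => w Qw z gz.
    by rewrite (_ : z = y)//; apply: gI; rewrite gy.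
  by apply: nearW => w z gz; exfalso; apply: no; exists z.
by apply: filterS => w Qw y; exact: Qw.
Qed.

Section transfer.
Context (R : realType) (AP : finType) d1 (X : measurableType d1)
  d2 (Y : measurableType d2).
Variables (T1 : lsts R AP X) (T2 : lsts R AP Y) (f : {mfun X >-> Y}) (B : set Y).
Hypotheses (dY : denumerable_chain Y) (absf : abstraction T1 T2 f)
  (sndf : sound T1 T2 f) (finB : finite_set B) (attB : attractor T2 B).
Local Notation "x ~~> y" := (reach (step T2) x y) (at level 70).
Local Notation Reach := (reach (step T2)).
Implicit Types (mu nu : probability X R).

Let mY (A : set Y) : measurable A. Proof. exact: dY.2. Qed.

Let mX (A : set Y) : measurable (f @^-1` A).
Proof. by rewrite -[X in measurable X]setTI; exact: measurable_funPT. Qed.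

Let gr : rel Y := fun x y => `[< [/\ B x, B y & x ~~> y] >].

(** Absorption of [Z] is applied to the image law of [nu]; equality of null sets carries the result
    back to [T1]. *)
Lemma absorbing_preimage Z : absorbing (trans T2) Z ->
  absorbing (trans T1) (f @^-1` Z).
Proof.
move=> aZ nu nuZ; apply: (absf nu (mY (~` Z))).2; exact: aZ.
Qed.

(** The image law of [nu] is carried by [Z], hence hits [A] almost surely in [T2]; soundness pulls
    this back to [nu]. *)
Lemma sound_hits Z A nu :
  (forall m : probability Y R, m (~` Z) = 0 ->
    chain_law (trans T2) m (eventually_in A) = 1) ->
  nu (~` (f @^-1` Z)) = 0 ->
  chain_law (trans T1) nu (avoid (f @^-1` A)) = 0.
Proof.
move=> h nuZ.
have e1 : chain_law (trans T1) nu (eventually_in (f @^-1` A)) = 1.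
  by apply: (sndf (mY A)); exact: h.
rewrite probability_setC ?e1 ?subee//.
exact: measurable_eventually_in (mX A).
Qed.

Lemma ae_stays mu : {ae chain_law (trans T1) mu, forall w, forall x n,
  Reach x (f (w n)) -> forall m, Reach x (f (w (n + m)%N))}.
Proof.
apply: ae_forall_denumerable => // x.
apply: ae_foralln => n.
(* The quantifier over [m] is moved in front of the implication so that it can be taken out of
   [ae]. *)
suff : {ae chain_law (trans T1) mu, forall w, forall m,
    Reach x (f (w n)) -> Reach x (f (w (n + m)%N))}.
  by apply: ae_mono => w h Rn m; exact: h.
apply: ae_foralln => m.
have aZ := absorbing_preimage (@reach_absorbing _ _ _ _ T2 dY x).
set Z := f @^-1` _ in aZ.
have mZ : measurable Z by exact: mX.
have mnZ := measurable_coord_preimage m (measurableC mZ).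
exists ([set w | Z (w n)] `&` shift_run n @^-1` [set w | (~` Z) (w m)]); split.
- apply: measurableI; first exact: measurable_coord_preimage.
  exact: measurable_shift_preimage.
- apply: chain_law_visit => // nu nuZ; exact: absorbing_coord.
- by move=> w /= /not_implyP.
Qed.

(** Return is asked only from states of [B], the vertices of the graph; [recurrent_back] extends it
    to every reachable state by passing through the attractor. *)
Definition recurrent x := B x /\ forall y, B y -> x ~~> y -> y ~~> x.

Lemma bscc_recurrentP C : bscc B gr C <->
  exists2 x, recurrent x & C = B `&` Reach x.
Proof.
split=> [/bsccP[x [Bx CE back]]|[x [Bx back] CE]].
  by exists x => //; split=> // y By xy; apply: back; rewrite CE.
by apply/bsccP; exists x; split=> // y; rewrite CE => -[By]; exact: back.
Qed.

Lemma recurrent_back x y : recurrent x -> x ~~> y -> y ~~> x.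
Proof.
move=> [Bx back] xy; have [b Bb yb] := attractor_reachable dY y attB.
by apply: (reach_trans yb); apply: back => //; exact: reach_trans yb.
Qed.

(** Each state of [B] reachable from [x] leads back to [x] and on to [y], so [y] is hit almost
    surely from any law on [Reach x] in [T2]. Soundness transfers this to [T1], and it is applied to
    the law of the path from each time n, whence infinitely many visits. *)
Lemma ae_revisits mu : {ae chain_law (trans T1) mu, forall w, forall x y n,
  recurrent x -> x ~~> y -> Reach x (f (w n)) ->
  exists2 m, (n <= m)%N & f (w m) = y}.
Proof.
apply: ae_forall_denumerable => // x; apply: ae_forall_denumerable => // y.
apply: ae_foralln => n.
have [rx|nrx] := pselect (recurrent x); last by apply: aeW.
have [xy|nxy] := pselect (x ~~> y); last by apply: aeW.
exists ([set w | (f @^-1` Reach x) (w n)] `&`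
  shift_run n @^-1` avoid (f @^-1` [set y])); split.
- apply: measurableI; first exact: measurable_coord_preimage (mX _).
  apply: measurable_shift_preimage; apply: measurableC.
  exact: measurable_eventually_in (mX _).
- apply: chain_law_visit => //.
    by apply: measurableC; exact: measurable_eventually_in (mX _).
  move=> nu; apply: sound_hits => m mZ.
  apply: (attractor_hits dY finB attB.2 (@reach_absorbing _ _ _ _ T2 dY x) mZ).
  move=> b Bb xb; apply: (reach_hits dY (y := y)) => //.
  exact: reach_trans (recurrent_back rx xb) xy.
- move=> w /= h; split; first by apply: contrapT => nR; apply: h.
  move=> [i /= fi]; apply: h => _ _ _; exists (n + i)%N => //; exact: leq_addr.
Qed.

(** The hitting argument is run with the whole space as absorbing set, since every state of [B]
    reaches some bottom component. *)
Lemma ae_absorbed mu : {ae chain_law (trans T1) mu, forall w,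
  exists C n, bscc B gr C /\ C (f (w n))}.
Proof.
pose D := [set y | exists2 C, bscc B gr C & C y].
exists (avoid (f @^-1` D)); split.
- by apply: measurableC; exact: measurable_eventually_in (mX _).
- apply: (@sound_hits setT) => [m _|]; last first.
    by rewrite preimage_setT setCT measure0.
  apply: (attractor_hits (Z := setT) dY finB attB.2) => //.
  + by move=> nu _; rewrite setCT integral0_eq// => x _; rewrite measure0.
  + by rewrite setCT measure0.
  + move=> b Bb _; have [C [c [bC Cc bc]]] := bscc_reachable (step T2) finB Bb.
    by apply: (reach_hits dY bc); exists C.
- by move=> w /= h [n [C bC Cn]]; apply: h; exists C, n.
Qed.

End transfer.

(** * Almost sure finite decompositions and measurability of the Muller condition *)

Lemma measure_ae_fin_bigcup d (T : measurableType d) (R : realType)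
    (P : probability T R) (I : choiceType) (D : set I) (F : I -> set T)
    (A : set T) :
  finite_set D -> (forall i, measurable (F i)) -> measurable A ->
  {ae P, forall w, (A w <-> exists2 i, D i & F i w) /\
    forall i j, D i -> D j -> F i w -> F j w -> i = j} ->
  P A = \sum_(i \in D) P (F i).
Proof.
move=> finD mF mA [N [mN N0 aeN]].
have PN (E : set T) : measurable E -> P (E `\` N) = P E.
  move=> mE; have : P E = P (E `\` N) + P (E `&` N) by exact: measureDI.
  suff -> : P (E `&` N) = 0 by rewrite adde0.
  apply/eqP; rewrite -measure_le0 -N0 le_measure ?inE//; exact: measurableI.
have notN w : ~ N w -> (A w <-> exists2 i, D i & F i w) /\
    forall i j, D i -> D j -> F i w -> F j w -> i = j.
  by move=> Nw; apply: contrapT => h; apply: Nw; exact: aeN.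
(* Off the null set [N] the union is genuinely disjoint, so finite additivity applies to the sets
   with [N] removed. *)
rewrite -PN// (_ : A `\` N = \bigcup_(i in D) (F i `\` N)); last first.
  apply/seteqP; split=> w.
    by move=> [Aw Nw]; have [[/(_ Aw)[i Di Fi] _] _] := notN w Nw; exists i.
  by move=> [i Di [Fi Nw]]; split=> //; apply/(notN w Nw).1; exists i.
rewrite [LHS]measure_fin_bigcup//; last 2 first.
- move=> i j Di Dj [w [[Fi Nw] [Fj _]]]; exact: (notN w Nw).2.
- by move=> i _; exact: measurableD.
by apply: eq_fsbigr => i _; exact: PN.
Qed.

Lemma measurable_Inf_in d (S : measurableType d) (AP : finType) (M : muller AP)
    (F : {set {set mstate M}}) : measurable (@Inf_in S AP M F).
Proof.
pose io (q : mstate M) : set (run (S * states M)%type) :=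
  \bigcap_n \bigcup_(m in [set m | (n <= m)%N]) [set w | (w m).2 = q].
have mio q : measurable (io q).
  apply: bigcapT_measurable => n; apply: bigcup_measurable => m _.
  apply: (measurable_coord_preimage m (A := [set y : S * states M | y.2 = q])).
  rewrite -[X in measurable X]setTI.
  exact: (@measurable_snd _ _ S (states M) measurableT [set q : states M]).
(* The event is split by the exact value G of the Inf-set, which fixes for each q whether [io q] or
   its complement holds. *)
have -> : @Inf_in S AP M F = \bigcup_(G in [set G | G \in F])
    \bigcap_(q in [set: mstate M]) (if q \in G then io q else ~` io q).
  have ioE w q : io q w <-> forall n, exists2 m, (n <= m)%N & (w m).2 = q.
    split=> h n; first by have [m nm qm] := h n I; exists m.
    by move=> _; have [m nm qm] := h n; exists m.
  apply/seteqP; split=> w.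
    move=> wF; eexists; first exact: wF.
    move=> q _; rewrite inE; case: asboolP => [h|h]; first exact/ioE.
    by move=> /ioE.
  move=> [G GF Gw]; rewrite /Inf_in /= (_ : [set q : mstate M | _]%SET = G)//.
  apply/setP => q; have := Gw q I; rewrite inE; case: ifPn => qG h.
    by apply/asboolP/ioE.
  by apply/asboolP => /ioE.
apply: fin_bigcup_measurable => [|G _]; first exact: finite_finset.
by apply: fin_bigcap_measurable => // q _; case: ifP => _ //; exact: measurableC.
Qed.

Lemma denumerable_prod d (S : measurableType d) (AP : finType) (M : muller AP) :
  denumerable_chain S -> denumerable_chain (S * states M)%type.
Proof.
move=> [cS mS]; split.
  rewrite -setXTT; apply: countableX; [exact: cS|exact: (@countableP (states M))].
move=> A.
rewrite (_ : A = \bigcup_(q in [set: states M]) ([set s | A (s, q)] `*` [set q])).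
  by apply: fin_bigcup_measurable => // q _; exact: measurableX.
by apply/seteqP; split=> [[s q] Asq|[s q] [q' _ [/= h ->]]//]; exists q.
Qed.

(** * Pathwise analysis of the product, for a fixed path with the almost sure properties *)

Section muller_product.
Context (R : realType) (AP : finType) d1 d2 (S1 : measurableType d1)
  (S2 : measurableType d2) (T1 : lsts R AP S1) (T2 : lsts R AP S2)
  (alpha : {mfun S1 >-> S2}) (M : muller AP) (B2 : set (S2 * states M)).
Local Notation f := (lift_abs alpha).
Local Notation Reach := (reach (step (prod_lsts T2 M))).

Hypotheses (dS2 : denumerable_chain S2) (attB : attractor (prod_lsts T2 M) B2).

Let inf_states (w : run (S1 * states M)) : {set mstate M} :=
  [set q : mstate M | `[< forall n, exists2 m, (n <= m)%N & (w m).2 = q >]]%SET.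

Variable w : run (S1 * states M)%type.
Hypothesis stays : forall x n,
  Reach x (f (w n)) -> forall m, Reach x (f (w (n + m)%N)).
Hypothesis revisits : forall x y n, recurrent (prod_lsts T2 M) B2 x ->
  Reach x y -> Reach x (f (w n)) -> exists2 m, (n <= m)%N & f (w m) = y.

(** After time n the path sees only states reachable from [x], by [stays], and returns to each of
    them, by [revisits]. *)
Lemma inf_statesP x n q : recurrent (prod_lsts T2 M) B2 x ->
  Reach x (f (w n)) -> q \in inf_states w <-> exists s, Reach x (s, q).
Proof.
move=> rx xn; rewrite inE; split=> [/asboolP h|[s xsq]].
  have [m nm <-] := h n; exists (alpha (w m).1).
  by rewrite -(subnKC nm); exact: stays.
apply/asboolP => l.
(* Starting from time n + l makes the visit later than the arbitrary bound [l]. *)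
have [|m lm fm] := revisits (n := n + l) rx xsq; first exact: stays.
by exists m; [apply: leq_trans lm; exact: leq_addl|have := congr1 snd fm].
Qed.

(** At time n + n' the path lies in both reachable sets; going back from there shows that [x] and
    [x'] reach each other. *)
Lemma bscc_unique C C' :
  bscc B2 (graph T2 B2) C -> bscc B2 (graph T2 B2) C' ->
  eventually_in (f @^-1` C) w -> eventually_in (f @^-1` C') w -> C = C'.
Proof.
move=> /bscc_recurrentP[x rx ->] /bscc_recurrentP[x' rx' ->] [n [_ xn]] [n' [_ xn']].
have xz : Reach x (f (w (n + n')%N)) by exact: stays.
have xz' : Reach x' (f (w (n + n')%N)) by rewrite addnC; exact: stays.
have dY := denumerable_prod M dS2.
have xx' := reach_trans xz (recurrent_back dY attB rx' xz').
have x'x := reach_trans xz' (recurrent_back dY attB rx xz).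
by apply/seteqP; split=> y [By xy]; split=> //; exact: reach_trans xy.
Qed.

(** Forwards, the component already entered is good, with the Inf-set itself as witness. Backwards,
    the two conditions of goodness force the witness [G] to be the Inf-set. *)
Lemma Inf_inP F : (exists C n, bscc B2 (graph T2 B2) C /\ C (f (w n))) ->
  Inf_in F w <-> exists2 C, Good T2 B2 F C & eventually_in (f @^-1` C) w.
Proof.
move=> [C [n [bC Cn]]]; split.
  move=> wF; exists C; last by exists n.
  split=> //; exists (inf_states w) => //.
  move: bC => /bscc_recurrentP[x rx CE]; move: (Cn); rewrite CE => -[_ xn].
  split=> [c s q [_ xc] cq|q /(inf_statesP _ rx xn)[s xs]].
    by apply/(inf_statesP _ rx xn); exists s; exact: reach_trans cq.
  by exists x, s; split=> //; split; [exact: rx.1|exact: reach_refl].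
move=> [C' [bC' [G GF [G1 G2]]] [n' Cn']].
move: bC' => /bscc_recurrentP[x rx CE].
have xn : Reach x (f (w n')) by move: Cn'; rewrite /= CE => -[].
rewrite /Inf_in /= (_ : [set q : mstate M | _]%SET = G)//.
apply/setP => q; apply/idP/idP.
  move=> /(inf_statesP _ rx xn)[s xs]; apply: (G1 x s) => //.
  by rewrite CE; split; [exact: rx.1|exact: reach_refl].
move=> /G2[c [s [Cc cs]]]; apply/(inf_statesP _ rx xn); exists s.
by move: Cc; rewrite CE => -[_ xc]; exact: reach_trans cs.
Qed.

End muller_product.

Theorem theorem51 (R : realType) (AP : finType)
    (d1 d2 : measure_display) (S1 : measurableType d1) (S2 : measurableType d2)
    (T1 : lsts R AP S1) (T2 : lsts R AP S2) (alpha : {mfun S1 >-> S2})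
    (M : muller AP) (B2 : set (S2 * states M)) :
  denumerable_chain S2 ->
  (exists B : set S2, finite_set B /\ attractor T2 B) ->
  labelled_abstraction T1 T2 alpha ->
  labelled_abstraction (prod_lsts T1 M) (prod_lsts T2 M) (lift_abs alpha) ->
  sound (prod_lsts T1 M) (prod_lsts T2 M) (lift_abs alpha) ->
  finite_set B2 -> attractor (prod_lsts T2 M) B2 ->
  forall mu : probability S1 R,
    Prob (prod_lsts T1 M) (mu \x dirac (minit M : states M)) (Inf_in (macc M)) =
    \sum_(C \in Good T2 B2 (macc M))
      Prob (prod_lsts T1 M) (mu \x dirac (minit M : states M))
        (eventually_in (lift_abs alpha @^-1` C)).
Proof.
move=> dS2 _ _ [absf _ _] sndf finB attB mu.
set nu := (X in Prob _ X).
have dY := denumerable_prod M dS2.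
apply: measure_ae_fin_bigcup.
(* Every bottom component is determined by one of its vertices in [B2], so the sum ranges over a
   finite set. *)
- apply: (@sub_finite_set _ _
    ((fun x => B2 `&` reach (step (prod_lsts T2 M)) x) @` B2)).
    by move=> C [/bscc_recurrentP[x rx ->] _]; exists x => //; exact: rx.1.
  exact: finite_image.
- move=> C; apply: measurable_eventually_in.
  by rewrite -[X in measurable X]setTI; apply: measurable_funPT => //; exact: dY.2.
- exact: measurable_Inf_in.
- have := ae_and (ae_and (ae_stays dY absf nu) (ae_revisits dY sndf finB attB nu))
    (ae_absorbed dY sndf finB attB nu).
  apply: ae_mono => w [[stays revisits] absorbed].
  split; first exact: Inf_inP.
  by move=> C C' [bC _] [bC' _]; exact: (bscc_unique dS2 attB stays).
Qed.
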